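(* Let $k\ge3$, $\vec m=(m_1,\ldots,m_k)\in\mathbb{Z}^k$, $\vec n=(n_1,\ldots,n_k)\in\mathbb{Z}_{>0}^k$, $S=\langle n_1,\ldots,n_k\rangle$, and let $A\in M_{2\times k}(\mathbb{Z})$ have rows $\vec m^{\mathsf T}$ and $\vec n^{\mathsf T}$. Assume: (a) $A\mathbb{Z}^k=\mathbb{Z}^2$; (b) $n\ge1$ is an integer and $\alpha,\beta\in\mathbb{R}\cup\{\pm\infty\}$ satisfy $\frac1n\le\beta-\alpha$; (c) $f:[\alpha,\beta]\to\mathbb{R}$ is continuous with $|f(x)|\le C_1$ for $x\in[\alpha,\beta]$; (d) for $x\in[\alpha,\beta]$, $|f(x)T_A((x,1)^{\mathsf T})|\le C_2$, and $x\mapsto f(x)T_A((x,1)^{\mathsf T})$ has Lipschitz constant $C_3$ on $[\alpha,\beta]$. Then \[ \left|\sum_{\substack{\vec x\in\mathsf{Z}_S(n)\\ \vec m\cdot(\vec x/n)\in[\alpha,\beta]}} f\Big(\frac{\vec m\cdot\vec x}{n}\Big)-n^{k-1}\int_\alpha^\beta f(t)\,\frac{M\big(t;\frac{m_1}{n_1},\ldots,\frac{m_k}{n_k}\big)}{(k-1)!\,n_1\cdots n_k}\,dt\right|\le E_3(n,k), \] where \[ E_3(n,k)=\Big((\beta-\alpha)\big(C_18^{k-3}(k-2)^{\frac{3k^2-7k-3}{2}}+C_3\big)+2C_2\Big)n^{k-2}+C_18^{k-3}(k-2)^{\frac{3k^2-7k-3}{2}}n^{k-3}. \]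
   Context: $\mathsf{Z}_S(n)=\{\vec x\in\mathbb{Z}_{\ge0}^k:\vec n\cdot\vec x=n\}$ (generators treated as a list, repetitions allowed). $T_A$ is the multivariate truncated power: $T_A(\vec b)=\operatorname{vol}_{k-2}\{\vec x\in\mathbb{R}^k_{\ge0}:A\vec x=\vec b\}/\sqrt{\det(AA^{\mathsf T})}$ (equivalently the unique function continuous on its support with $\int f(\vec b)T_A(\vec b)d\vec b=\int_{\mathbb{R}^k_{\ge0}}f(A\vec z)d\vec z$ for continuous compactly supported $f$). Curry–Schoenberg B-spline: for sorted knots $a_1\le\cdots\le a_r$, not all equal, $M(x;a_1,\ldots,a_r)=(r-1)M_{1,r-1}(x)$ where $M_{i,1}(x)=(a_{i+1}-a_i)^{-1}$ on $[a_i,a_{i+1})$ and $0$ otherwise, and $M_{i,j}(x)=\frac{x-a_i}{a_{i+j}-a_i}M_{i,j-1}(x)+\frac{a_{i+j}-x}{a_{i+j}-a_i}M_{i+1,j-1}(x)$; equivalently it is the density of $\sum t_ia_i$ with $t$ uniform on the standard simplex. Unordered knots are first sorted. *)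

(* Defs.v *)
From HB Require Import structures.
From mathcomp Require Import all_boot all_order all_algebra.
From mathcomp Require Import all_classical all_reals all_analysis.

Set Implicit Arguments.
Unset Strict Implicit.
Unset Printing Implicit Defensive.

Import Order.TTheory GRing.Theory Num.Theory.
Import numFieldNormedType.Exports.

Local Open Scope classical_set_scope.
Local Open Scope ring_scope.

Definition cdot (R : comNzRingType) (k : nat) (u v : 'cV[R]_k) : R :=
  \sum_(i < k) u i 0 * v i 0.

(* Z_S(n), where S is the numerical semigroup generated by the entries of g;
   the generators form a list, so that repeated entries are distinct
   coordinates. *)
Definition factorizations (k : nat) (g : 'cV[int]_k) (n : int) :
    set 'cV[int]_k :=
  [set x : 'cV[int]_k | (forall i, 0 <= x i 0) /\ cdot g x = n].

(* [alpha, beta] with endpoints allowed to be infinite, as a set of reals. *)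
Definition eitv (R : realType) (alpha beta : \bar R) : set R :=
  [set x : R | (alpha <= x%:E <= beta)%E].

(* d-dimensional Lebesgue measure, for measurable P, as the iterated integral
   of the indicator function of P (Tonelli). *)
Fixpoint lebesgue_vol (R : realType) (d : nat) : set 'rV[R]_d -> \bar R :=
  match d with
  | 0 => fun P => (\1_P 0)%:E
  | d'.+1 => fun P =>
      (\int[@lebesgue_measure R]_t
         lebesgue_vol [set v : 'rV[R]_d' | P (row_mx (t%:M : 'rV_1) v)])%E
  end.

(* (\rank W)-dimensional volume of the part of P lying in the affine subspace
   p + (row space of W). If the rows of B form a basis of the row space of W,
   the parametrization y |-> p + y B multiplies volumes by the square root of
   the Gram determinant det (B B^T). *)
Definition flat_vol (R : realType) (k l : nat) (W : 'M[R]_(l, k))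
    (p : 'rV[R]_k) (P : set 'rV[R]_k) : \bar R :=
  let B := row_base W in
  ((Num.sqrt (\det (B *m B^T)))%:E *
   lebesgue_vol [set y : 'rV[R]_(\rank W) | P (p + y *m B)%R])%E.

(* The multivariate truncated power T_A. Points of R^k are stored as columns,
   and transposed where the row-space theory of matrices is used:
   b^T *m pinvmx A^T is the transpose of one solution of A x = b (if there is
   any) and kermx A^T spans the transposes of the solutions of A x = 0, which
   form a space of dimension k - 2 when A has rank 2. The volume is finite when
   A has a row with positive entries; an infinite volume would give 0. *)
Definition trunc_power (R : realType) (k : nat) (A : 'M[R]_(2, k))
    (b : 'cV[R]_2) : R :=
  fine (flat_vol (kermx A^T) (b^T *m pinvmx A^T)
          [set x : 'rV[R]_k | (forall i, 0 <= x 0 i) /\ A *m x^T = b])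
  / Num.sqrt (\det (A *m A^T)).

(* The functions M_{i,j} for the knot sequence a. Indices are shifted by one:
   bspline_rec a i j is M_{i+1,j+1}, and a`_i is the knot a_{i+1}. Terms with a
   vanishing denominator are 0, because x / 0 = 0. *)
Fixpoint bspline_rec (R : realType) (a : seq R) (i j : nat) (x : R) : R :=
  match j with
  | 0 => if a`_i <= x < a`_i.+1 then (a`_i.+1 - a`_i)^-1 else 0
  | j'.+1 =>
      (x - a`_i) / (a`_(i + j.+1) - a`_i) * bspline_rec a i j' x
      + (a`_(i + j.+1) - x) / (a`_(i + j.+1) - a`_i)
        * bspline_rec a i.+1 j' x
  end.

(* The Curry-Schoenberg B-spline M(x; a_1, ..., a_r), where r = size a. *)
Definition bspline (R : realType) (a : seq R) (x : R) : R :=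
  let s := sort <=%O a in
  (size s).-1%:R * bspline_rec s 0 (size s).-2 x.

Definition trunc_power1 (R : realType) (k : nat) (A : 'M[int]_(2, k)) (x : R) :
    R :=
  trunc_power (map_mx intr A) (col_mx (x%:M : 'cV[R]_1) (1%:M : 'cV[R]_1)).

Definition ratio_knots (R : realType) (k : nat) (m g : 'cV[int]_k) : seq R :=
  [seq (m i 0)%:~R / (g i 0)%:~R | i <- enum 'I_k].

Definition E3 (R : realType) (alpha beta : \bar R) (C1 C2 C3 : R) (n k : nat) :
    \bar R :=
  let K : R := C1 * 8 ^+ (k - 3) *
    (k%:R - 2) `^ ((3 * k%:R ^+ 2 - 7 * k%:R - 3) / 2) in
  (((beta - alpha) * (K + C3)%R%:E + (2 * C2)%R%:E) *
     (n%:R ^+ (k - 2))%R%:E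
   + (K * n%:R ^+ (k - 3))%R%:E)%E.

(* Main.v *)
(* Group the sum by the value j = m.x.  The number of x in Z^k_{>=0} with m.x = j and
   g.x = n is the number of lattice points of a polytope of dimension d = k - 2, and
   surjectivity of A makes T_A(j, n) = n^d T_A(j/n, 1) its volume in a basis of the
   kernel lattice.  This lattice has a basis in which all coordinates of the
   polytope vary by at most d n (Hermite reduction), so Davenport's slicing argument
   gives |count - n^d T_A(j/n, 1)| <= d (d n + 1)^(d - 1), well below the stated
   constant.  What remains is a Riemann sum for the Lipschitz function f T_A, and the
   identity T_A(x, 1) = M(x) / ((k - 1)! g_1 ... g_k) off the knots, obtained by
   cutting a slice of the simplex into two cones over facets: their volumes satisfy
   the two-term recurrence that defines the B-spline M. *)
Require Import Defs.
From HB Require Import structures.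
From mathcomp Require Import all_boot all_order all_algebra.
From mathcomp Require Import all_classical all_reals all_analysis.
From mathcomp Require Import measurable_realfun perm.
From mathcomp Require Import ring lra zify.

Set Implicit Arguments.
Unset Strict Implicit.
Unset Printing Implicit Defensive.

Import Order.TTheory GRing.Theory Num.Theory.
Import numFieldNormedType.Exports.

Local Open Scope classical_set_scope.
Local Open Scope ring_scope.


(** * Volumes of polyhedra *)

Section polyhedra.
Variable R : realType.
Implicit Types d k : nat.
Local Notation mu := (@lebesgue_measure R).

(** [lebesgue_vol] integrates along fixed coordinate axes, so its behaviour under linear maps has to
    be derived. Every body is therefore written as the set of [y] with [c + y *m B] nonnegative:
    slices, translates, linear images and cuts by half-spaces keep this form, which allows induction
    on the dimension with [c] as a parameter. [trunc_power] is computed in an unspecified basis of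
    the kernel, corrected by Gram determinants. The change of variables replaces it by any kernel
    basis [B], at the price of a factor [|det W|], where [W] completes [B] by a left inverse of
    [A^T]. This one formula serves both halves of the proof: for a basis of the kernel lattice the
    factor is 1, and for a basis adapted to the extreme knots it produces the product of the
    generators. The lattice basis must be reduced because the slicing error depends on the diameter
    of the polytope in the chosen coordinates; for an arbitrary basis that diameter has no bound in
    terms of [d] and [n] alone. Knots obstruct the spline identity pointwise, but they are finitely
    many and the identity is only used under an integral. *)

Definition polyh d k (c : 'rV[R]_k) (B : 'M[R]_(d, k)) : set 'rV[R]_d :=
  [set y | forall i, 0 <= (c + y *m B) 0 i].

Definition pvol d k (c : 'rV[R]_k) (B : 'M[R]_(d, k)) : \bar R :=
  lebesgue_vol (polyh c B).

Lemma polyh_slice d k (c : 'rV[R]_k) (B : 'M[R]_(1 + d, k)) (t : R) :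
  [set v : 'rV[R]_d | polyh c B (row_mx (t%:M : 'rV[R]_1) v)] =
  polyh (c + t *: usubmx B) (dsubmx B).
Proof.
apply/seteqP; split => v /= + i => /(_ i).
  by rewrite -{1}(vsubmxK B) mul_row_col mul_scalar_mx addrA.
by rewrite -{3}(vsubmxK B) mul_row_col mul_scalar_mx addrA.
Qed.

Lemma pvolS d k (c : 'rV[R]_k) (B : 'M[R]_(1 + d, k)) :
  pvol c B = (\int[mu]_t pvol (c + t *: usubmx B) (dsubmx B))%E.
Proof.
by rewrite /pvol /=; apply: eq_integral => t _; rewrite polyh_slice.
Qed.

Lemma pvol0 k (c : 'rV[R]_k) (B : 'M[R]_(0, k)) :
  pvol c B = ([forall i, 0 <= c 0 i]%:R)%:E.
Proof.
rewrite /pvol /= indicE; congr (_%:R)%:E; congr nat_of_bool.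
apply/idP/forallP => [|h]; last first.
  by rewrite inE => i; rewrite mul0mx addr0.
by rewrite inE => h i; have := h i; rewrite mul0mx addr0.
Qed.

Lemma pvol_ge0 d k (c : 'rV[R]_k) (B : 'M[R]_(d, k)) : (0 <= pvol c B)%E.
Proof.
elim: d k c B => [|d ih] k c B; first by rewrite pvol0 lee_fin.
by rewrite (@pvolS d); apply: integral_ge0.
Qed.

(** The parameter space [T] is arbitrary because the induction passes to [T] times the reals: the
    outermost integration variable joins the parameters, and Tonelli makes the partial integral
    measurable. *)
Lemma measurable_pvol d k (dT : measure_display) (T : measurableType dT)
    (c : T -> 'rV[R]_k) (B : 'M[R]_(d, k)) :
  (forall i, measurable_fun setT (fun x => c x 0 i)) ->
  measurable_fun [set: T] ((fun x => pvol (c x) B) : T -> \bar R).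
Proof.
elim: d dT T c B => [|d ih] dT T c B mc.
  under eq_fun do rewrite pvol0.
  apply/measurable_EFinP.
  rewrite (_ : (fun _ => _) =
    \1_(\bigcap_(i in [set: 'I_k]) [set x | 0 <= c x 0 i])); last first.
    apply/funext => x; rewrite indicE; congr (nat_of_bool _)%:R.
    apply/forallP/idP => [h|]; first by rewrite inE => i _; exact: h.
    by rewrite inE => h i; exact: h.
  apply: measurable_indic; apply: fin_bigcap_measurable => //.
  move=> i _; rewrite -[X in measurable X]setTI.
  have -> : [set x | 0 <= c x 0 i] = (fun x => c x 0 i) @^-1` `[0, +oo[.
    by apply/seteqP; split => x /=; rewrite in_itv /= andbT.
  exact: mc.
under eq_fun do rewrite (@pvolS d).
pose F (p : T * measurableTypeR R) :=
  pvol (c p.1 + p.2 *: usubmx (B : 'M[R]_(1 + d, k)))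
    (dsubmx (B : 'M[R]_(1 + d, k))).
apply: (@measurable_fun_fubini_tonelli_F _ _ _ _ _ mu F); last first.
  by move=> p; exact: pvol_ge0.
apply: ih => i; under eq_fun do rewrite !mxE.
apply: measurable_funD; first by apply: (measurableT_comp (mc i)).
by apply: measurable_funM.
Qed.

Lemma measurable_affine (a s : R) :
  measurable_fun setT ((fun t => a * t + s) : measurableTypeR R -> measurableTypeR R).
Proof. by apply: measurable_funD => //; apply: measurable_funM. Qed.

(** Scaled by [|a|], the pushforward of Lebesgue measure under [t |-> a * t + s] agrees with
    Lebesgue measure on half-open intervals, hence everywhere. Together with Tonelli this is the
    analytic input to the linear change of variables. *)
Lemma ge0_integral_affine (F : measurableTypeR R -> \bar R) (a s : R) : a != 0 ->
  measurable_fun setT F -> (forall t, 0 <= F t)%E ->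
  (`|a|%:E * \int[mu]_t F (a * t + s)%R = \int[mu]_t F t)%E.
Proof.
move=> a0 mF F0.
pose phi : measurableTypeR R -> measurableTypeR R := fun t => a * t + s.
have mphi : measurable_fun setT phi by exact: measurable_affine.
have a_ge0 : 0 <= `|a| by [].
pose nu : {measure set (measurableTypeR R) -> \bar R} :=
  mscale (NngNum a_ge0) (pushforward mu phi).
have E A : measurable A -> mu A = nu mphi A.
  apply: lebesgue_measure_unique => _ [[x y] _ <-].
  rewrite /nu /= /mscale /pushforward /=.
  rewrite lebesgue_measure_itv /= lte_fin.
  rewrite /pushforward (_ : phi @^-1` `]x, y] =
     if 0 < a then `](x - s) / a, (y - s) / a]%classic
     else `[(y - s) / a, (x - s) / a[%classic); last first.
    apply/seteqP; rewrite /phi; case: ltgtP a0 => // ha _; split => t /=;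
      rewrite !in_itv /=.
    - by rewrite ler_pdivlMr // ltr_pdivrMr // ltrBlDr lerBrDr [t * a]mulrC.
    - by rewrite ler_pdivlMr // ltr_pdivrMr // ltrBlDr lerBrDr [t * a]mulrC.
    - by rewrite ltr_ndivlMr // ler_ndivrMr // ltrBlDr lerBrDr [t * a]mulrC andbC.
    - by rewrite ltr_ndivlMr // ler_ndivrMr // ltrBlDr lerBrDr [t * a]mulrC andbC.
  case: (ltgtP a 0) a0 => //= ha _; rewrite lebesgue_measure_itv /= lte_fin.
  - rewrite ltr_nM2r ?invr_lt0 // ltrD2r; case: ifP => _; last by rewrite mule0.
    rewrite ltr0_norm // -!EFinD -EFinM; congr _%:E; field; lra.
  - rewrite ltr_pM2r ?invr_gt0 // ltrD2r; case: ifP => _; last by rewrite mule0.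
    rewrite gtr0_norm // -!EFinD -EFinM; congr _%:E; field; lra.
rewrite [RHS](eq_measure_integral (nu mphi)) => [|A mA _]; last exact: E.
rewrite ge0_integral_mscale //.
rewrite ge0_integral_pushforward //.
Qed.


Lemma pvol_shift d k (c : 'rV[R]_k) (B : 'M[R]_(d, k)) (w : 'rV[R]_d) :
  pvol (c + w *m B) B = pvol c B.
Proof.
elim: d k c B w => [|d ih] k c B w; first by rewrite thinmx0 mul0mx addr0.
change 'M[R]_(1 + d, k) in B; change 'rV[R]_(1 + d) in w.
rewrite !(@pvolS d) -[RHS](@ge0_integral_affine _ 1 (w 0 0)) ?oner_neq0 //.
- rewrite normr1 mul1e; apply: eq_integral => t _.
  rewrite -(ih _ (c + (1 * t + w 0 0) *: usubmx B) _ (rsubmx w)).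
  congr (pvol _ _).
  have -> : w *m B = w 0 0 *: usubmx B + rsubmx w *m dsubmx B.
    rewrite -[in LHS](hsubmxK w) -[in LHS](vsubmxK B) mul_row_col -mul_scalar_mx.
    congr (_ *m _ + _); apply/rowP => i; rewrite !mxE ord1 eqxx mulr1n.
    by congr (w _ _); apply: val_inj.
  rewrite mul1r scalerDl; set x := w 0 0 *: _; set y := _ *m _; set z := t *: _.
  by rewrite -!addrA [y + z]addrC [x + _]addrCA.
- apply: measurable_pvol => i; under eq_fun do rewrite !mxE.
  by apply: measurable_funD => //; apply: measurable_funM.
- by move=> t; exact: pvol_ge0.
Qed.

Lemma measurable_pvol_line d k (c u : 'rV[R]_k) (B : 'M[R]_(d, k)) :
  measurable_fun [set: measurableTypeR R] (fun t => pvol (c + t *: u) B).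
Proof.
apply: measurable_pvol => i; under eq_fun do rewrite !mxE.
by apply: measurable_funD => //; apply: measurable_funM.
Qed.

Lemma pvol_col d k (c u : 'rV[R]_k) (B : 'M[R]_(d, k)) :
  pvol c (col_mx u B) = (\int[mu]_t pvol (c + t *: u) B)%E.
Proof. by rewrite (@pvolS d) col_mxKu col_mxKd. Qed.

Lemma pvol_swap d k (c u v : 'rV[R]_k) (B : 'M[R]_(d, k)) :
  pvol c (col_mx u (col_mx v B)) = pvol c (col_mx v (col_mx u B)).
Proof.
rewrite !pvol_col.
under eq_integral do rewrite pvol_col.
under [RHS]eq_integral do rewrite pvol_col.
pose F (p : measurableTypeR R * measurableTypeR R) :=
  pvol (c + p.1 *: u + p.2 *: v) B.
rewrite (fubini_tonelli F).
- by apply: eq_integral => t _; apply: eq_integral => s _; rewrite /F /= addrAC.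
- apply: measurable_pvol => i; under eq_fun do rewrite !mxE.
  apply: measurable_funD; last by apply: measurable_funM.
  by apply: measurable_funD => //; apply: measurable_funM.
- by move=> p; exact: pvol_ge0.
Qed.

Lemma pvol_upper d k (c u : 'rV[R]_k) (B : 'M[R]_(d, k)) (a : R) (w : 'rV[R]_d) :
  a != 0 ->
  (`|a|%:E * pvol c (col_mx (a *: u + w *m B) B) = pvol c (col_mx u B))%E.
Proof.
move=> a0; rewrite !pvol_col -[RHS](@ge0_integral_affine _ a 0) //.
- congr (_ * _)%E; apply: eq_integral => t _.
  rewrite -[RHS](pvol_shift _ _ (t *: w)) scalerDr scalerA addr0 -scalemxAl.
  by rewrite addrA mulrC.
- exact: measurable_pvol_line.
- by move=> t; exact: pvol_ge0.
Qed.

(** Adding multiples of the outermost row to inner rows shifts the outer variable by an amount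
    depending on the inner ones. Tonelli moves [u] inward past one row; the induction hypothesis
    then clears the rows below, and [pvol_upper] the row that is now on top. *)
Lemma pvol_lower d k (c u : 'rV[R]_k) (B : 'M[R]_(d, k)) (x : 'cV[R]_d) :
  pvol c (col_mx u (B + x *m u)) = pvol c (col_mx u B).
Proof.
elim: d c B x => [|d ih] c; first by move=> B x; rewrite [x]flatmx0 mul0mx addr0.
change (forall (B : 'M[R]_(1 + d, k)) (x : 'cV[R]_(1 + d)),
  pvol c (col_mx u (B + x *m u)) = pvol c (col_mx u B)) => B x.
rewrite -(vsubmxK B) -(vsubmxK x) mul_col_mx add_col_mx.
set v := usubmx B; set D := dsubmx B; set y := usubmx x; set z := dsubmx x.
transitivity (pvol c (col_mx (v + y *m u) (col_mx u D))).
  rewrite pvol_swap [LHS]pvol_col [RHS]pvol_col.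
  by apply: eq_integral => t _; exact: ih.
have := @pvol_upper _ _ c v (col_mx u D) 1 (row_mx y 0) (oner_neq0 _).
by rewrite normr1 mul1e scale1r mul_row_col mul0mx addr0 pvol_swap => ->.
Qed.

(** The second factor is the determinant of the Schur complement of the pivot [a]. *)
Lemma det_block1 d (a : R) (w : 'rV[R]_d) (v : 'cV[R]_d) (G : 'M[R]_d) : a != 0 ->
  \det (block_mx a%:M w v G) = a * \det (G - a^-1 *: (v *m w)).
Proof.
move=> a0.
have -> : block_mx a%:M w v G =
  block_mx 1%:M 0 (a^-1 *: v) 1%:M *m block_mx a%:M w 0 (G - a^-1 *: (v *m w)).
  rewrite mulmx_block !mul1mx !mul0mx !addr0 mul_mx_scalar scalerA mulfV //.
  by rewrite scale1r -scalemxAl addrC subrK.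
by rewrite det_mulmx det_lblock det_ublock !det1 !mul1r det_scalar1.
Qed.

(* Gaussian elimination on the rows of G; a vanishing pivot is repaired by adding
   v^T times the rows below to the first row, where v is the rest of its column,
   which turns the pivot into |v|^2. *)
Lemma pvol_unit d k (c : 'rV[R]_k) (G : 'M[R]_d) (B : 'M[R]_(d, k)) :
  G \in unitmx -> (`|\det G|%:E * pvol c (G *m B) = pvol c B)%E.
Proof.
elim: d c G B => [|d ih] c.
  by move=> G B _; rewrite det_mx00 normr1 mul1e !pvol0.
change (forall (G : 'M[R]_(1 + d)) (B : 'M[R]_(1 + d, k)), G \in unitmx ->
  (`|\det G|%:E * pvol c (G *m B) = pvol c B)%E) => G B.
rewrite unitmxE unitfE -(vsubmxK B) -(submxK G) (mx11_scalar (ulsubmx G)).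
move: (ulsubmx G 0 0) (ursubmx G) (dlsubmx G) (drsubmx G) => a w v H.
move: (usubmx B) (dsubmx B) => u D {G B}.
have pivot (a' : R) (w' : 'rV[R]_d) (H' : 'M[R]_d) : a' != 0 ->
    \det (block_mx a'%:M w' v H') != 0 ->
    (`|\det (block_mx a'%:M w' v H')|%:E *
       pvol c (block_mx a'%:M w' v H' *m col_mx u D) = pvol c (col_mx u D))%E.
  move=> a0; rewrite det_block1 // mulf_eq0 (negbTE a0) /=.
  set H2 := H' - _ => H0; rewrite mul_block_col mul_scalar_mx.
  have -> : v *m u + H' *m D = H2 *m D + (a'^-1 *: v) *m (a' *: u + w' *m D).
    rewrite /H2 mulmxBl mulmxDr -!scalemxAl -!scalemxAr scalerA mulVf // scale1r.
    by rewrite -mulmxA addrCA subrK.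
  rewrite pvol_lower normrM EFinM -muleA.
  rewrite -[RHS](pvol_upper _ _ _ w' a0); congr (_ * _)%E.
  rewrite !pvol_col -ge0_integralZl_EFin //.
  - by apply: eq_integral => t _; rewrite ih // unitmxE unitfE.
  - by move=> t _; exact: pvol_ge0.
  - exact: measurable_pvol_line.
move=> G0; have [a0|] := eqVneq a 0; last by move=> ?; exact: pivot.
rewrite {a}a0 in G0 *.
have v0 : (v^T *m v) 0 0 != 0.
  apply: contraNneq G0; rewrite mxE => /eqP; rewrite psumr_eq0 => [|i _]; last first.
    by rewrite mxE -expr2 sqr_ge0.
  move=> /allP v0; suff -> : v = 0 by rewrite det_ublock det_scalar1 mul0r.
  apply/colP => i; have := v0 i; rewrite mem_index_enum mxE mulf_eq0 orbb mxE.
  by move=> /(_ isT)/eqP.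
pose P : 'M[R]_(1 + d) := block_mx 1%:M v^T 0 1%:M.
have PG : P *m block_mx (0%:M) w v H =
    block_mx ((v^T *m v) 0 0)%:M (w + v^T *m H) v H.
  rewrite mulmx_block !mul1mx !mul0mx !add0r -mx11_scalar.
  by rewrite [0%:M]raddf0 add0r.
have dP : \det (P *m block_mx 0%:M w v H) = \det (block_mx 0%:M w v H).
  by rewrite det_mulmx det_ublock !det1 !mul1r.
have PZ (Z : 'M[R]_(1 + d, k)) : pvol c (P *m Z) = pvol c Z.
  rewrite -(vsubmxK Z) mul_block_col !mul1mx mul0mx add0r.
  have := @pvol_upper _ _ c (usubmx Z) (dsubmx Z) 1 v^T (oner_neq0 _).
  by rewrite normr1 mul1e scale1r => ->.
rewrite -dP PG -[RHS](pivot _ (w + v^T *m H) H v0); last by rewrite -PG dP.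
by rewrite -PG -mulmxA PZ.
Qed.

End polyhedra.

(** * Homogeneity, cuts by hyperplanes and diameter bounds *)

Section volume.
Variable R : realType.
Local Notation mu := (@lebesgue_measure R).

Lemma pvol_homog d k (c : 'rV[R]_k) (B : 'M[R]_(d, k)) (s : R) : 0 < s ->
  pvol (s *: c) B = ((s ^+ d)%:E * pvol c B)%E.
Proof.
move=> s0; have us : s%:M \in @unitmx R d.
  by rewrite unitmxE det_scalar unitrX // unitfE gt_eqF.
rewrite -(pvol_unit (s *: c) B us) det_scalar gtr0_norm ?exprn_gt0 //.
have sE (v : 'rV[R]_k) i : (0 <= (s *: v) 0 i) = (0 <= v 0 i).
  by rewrite mxE pmulr_rge0.
congr (_ * lebesgue_vol _)%E; apply/seteqP; split => y /= + i => /(_ i);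
  by rewrite mul_scalar_mx -scalemxAr -scalerDr sE.
Qed.

Lemma lebesgue_vol0 d : @lebesgue_vol R d set0 = 0%E.
Proof.
elim: d => [|d ih] /=; first by rewrite indicE in_set0.
by apply: integral0_eq => t _; rewrite -[RHS]ih.
Qed.

Lemma pvol_empty d k (c : 'rV[R]_k) (B : 'M[R]_(d, k)) :
  (forall y, ~ polyh c B y) -> pvol c B = 0%E.
Proof.
move=> h; rewrite /pvol (_ : polyh c B = set0) ?lebesgue_vol0 //.
by apply/seteqP; split.
Qed.

Lemma polyh_row_mx d k l (c : 'rV[R]_k) (B : 'M[R]_(d, k)) (c' : 'rV[R]_l)
    (B' : 'M[R]_(d, l)) :
  polyh (row_mx c c') (row_mx B B') = polyh c B `&` polyh c' B'.
Proof.
apply/seteqP; rewrite /polyh; split => y /=.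
  by move=> h; split => i; [have := h (lshift l i)|have := h (rshift k i)];
    rewrite mul_mx_row add_row_mx ?row_mxEl ?row_mxEr.
move=> [h h'] i; rewrite mul_mx_row add_row_mx; case: (split_ordP i) => j ->;
  by rewrite ?row_mxEl ?row_mxEr.
Qed.

(** The two pieces overlap in the hyperplane [g + y *m b = 0], which has to be negligible. If the
    lower part of [b] is nonzero, every slice splits by induction; otherwise the cut depends on the
    outermost variable alone and a single slice lies in it. *)
Lemma pvol_split d k (c : 'rV[R]_k) (B : 'M[R]_(d, k)) (g : 'M[R]_1)
    (b : 'cV[R]_d) : b != 0 ->
  (pvol c B = pvol (row_mx c g) (row_mx B b) +
              pvol (row_mx c (- g)) (row_mx B (- b)))%E.
Proof.
elim: d c g B b => [|d ih] c g; first by move=> B b; rewrite [b]flatmx0 eqxx.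
change (forall (B : 'M[R]_(1 + d, k)) (b : 'cV[R]_(1 + d)), b != 0 ->
  (pvol c B = pvol (row_mx c g) (row_mx B b) +
              pvol (row_mx c (- g)) (row_mx B (- b)))%E) => B b.
rewrite -(vsubmxK B) -(vsubmxK b).
move: (usubmx B) (dsubmx B) (usubmx b) (dsubmx b) => u D b0 b' {B b} bn0.
rewrite opp_col_mx -!block_mxEh !block_mxEv !pvol_col.
have -> : (\int[mu]_t pvol (row_mx c g + t *: row_mx u b0) (row_mx D b') +
  \int[mu]_t pvol (row_mx c (- g) + t *: row_mx u (- b0)) (row_mx D (- b')) =
  \int[mu]_t (pvol (row_mx c g + t *: row_mx u b0) (row_mx D b') +
    pvol (row_mx c (- g) + t *: row_mx u (- b0)) (row_mx D (- b'))))%E.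
  by rewrite ge0_integralD //; try exact: measurable_pvol_line;
    move=> t _; exact: pvol_ge0.
have [b'0|b'n0] := eqVneq b' 0; last first.
  apply: eq_integral => t _.
  by rewrite !scale_row_mx !add_row_mx scalerN -opprD -ih.
have b00 : b0 0 0 != 0.
  apply: contraNneq bn0 => b00; rewrite b'0 (mx11_scalar b0) b00.
  by rewrite [0%:M]raddf0 col_mx0.
apply: ge0_ae_eq_integral => //.
- exact: measurable_pvol_line.
- by apply: emeasurable_funD; exact: measurable_pvol_line.
- by move=> t _; exact: pvol_ge0.
- by move=> t _; apply: adde_ge0; exact: pvol_ge0.
exists [set - g 0 0 / b0 0 0]; split => //.
  exact: lebesgue_measure_set1.
move=> t /=; apply: contra_notP => tn _.
have h0 : (g + t *: b0) 0 0 != 0.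
  rewrite !mxE; apply/eqP => /eqP; rewrite addrC addr_eq0 => /eqP e.
  by apply: tn; rewrite -e mulfK.
rewrite b'0 oppr0 !scale_row_mx !add_row_mx /pvol !polyh_row_mx scalerN -opprD.
move: (g + _) h0 => {tn}; move=> h.
have E (x : 'M[R]_1) : polyh x (0 : 'M[R]_(d, 1)) =
    if 0 <= x 0 0 then setT else set0.
  case: ifPn => hx; apply/seteqP; split => y //=.
    by move=> _ i; rewrite mulmx0 addr0 !ord1.
  by move=> /(_ 0); rewrite mulmx0 addr0 (negbTE hx).
rewrite !E mxE oppr_ge0; case: ltgtP => // _ _;
  by rewrite setIT setI0 lebesgue_vol0 ?adde0 ?add0e.
Qed.

Lemma diam_sub_itv (T : set R) (L : R) : 0 <= L ->
  (forall s t, T s -> T t -> `|s - t| <= L) ->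
  exists a, forall t, T t -> a <= t <= a + L.
Proof.
move=> L0 TL; have [->|/set0P[s Ts]] := eqVneq T set0; first by exists 0.
have lbT : has_lbound T.
  by exists (s - L) => t Tt; have := TL _ _ Ts Tt; rewrite ler_norml; lra.
exists (inf T) => t Tt; apply/andP; split; first exact: ge_inf.
rewrite -lerBlDr; apply: lb_le_inf; first by exists s.
by move=> r Tr; have := TL _ _ Tt Tr; rewrite ler_norml; lra.
Qed.

Lemma integral_bound_itv (F : measurableTypeR R -> \bar R) (a L M : R) :
  0 <= L -> 0 <= M -> measurable_fun setT F ->
  (forall t, 0 <= F t <= M%:E)%E ->
  (forall t, ~~ (a <= t <= a + L) -> F t = 0%E) ->
  (\int[mu]_t F t <= (M * L)%:E)%E.
Proof.
move=> L0 M0 mF F0 Fa.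
apply: (@le_trans _ _ (\int[mu]_(t in setT) (M%:E * (\1_(`[a, a + L]) t)%:E))%E).
  apply: ge0_le_integral => //.
  - by move=> t _; case/andP: (F0 t).
  - by apply: measurable_funeM; apply/measurable_EFinP; exact: measurable_indic.
  move=> t _; rewrite indicE; case: (boolP (t \in _)) => [_|].
    by rewrite mule1; case/andP: (F0 t).
  by rewrite notin_setE /= in_itv /= => /negP /Fa ->; rewrite mule0.
rewrite ge0_integralZl_EFin //; last first.
  by apply/measurable_EFinP; exact: measurable_indic.
rewrite integral_indic // setIT /= lebesgue_measure_itv /= lte_fin.
case: ifP => _; last by rewrite mule0 lee_fin mulr_ge0.
by rewrite -EFinD -EFinM lee_fin addrAC subrr add0r.
Qed.

Definition diam_le d (P : set 'rV[R]_d) (L : R) :=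
  forall y z, P y -> P z -> forall j, `|y 0 j - z 0 j| <= L.

Lemma diam_le_slice d k (c u : 'rV[R]_k) (D : 'M[R]_(d, k)) (L : R) :
  diam_le (polyh c (col_mx u D)) L ->
  forall s t y z, polyh (c + s *: u) D y -> polyh (c + t *: u) D z ->
  `|s - t| <= L /\ forall j, `|y 0 j - z 0 j| <= L.
Proof.
move=> dP s t y z.
have E (r : R) (x : 'rV[R]_d) : polyh (c + r *: u) D x ->
    polyh c (col_mx u D) (row_mx (r%:M : 'M[R]_1) x).
  by move=> h i; have := h i; rewrite mul_row_col mul_scalar_mx addrA.
move=> /E Py /E Pz; split => [|j].
  by have := dP _ _ Py Pz (lshift d 0); rewrite !row_mxEl !mxE eqxx !mulr1n.
by have := dP _ _ Py Pz (rshift 1 j); rewrite !row_mxEr.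
Qed.

Lemma pvol_diam d k (c : 'rV[R]_k) (B : 'M[R]_(d, k)) (L : R) : 0 <= L ->
  diam_le (polyh c B) L -> (pvol c B <= (L ^+ d)%:E)%E.
Proof.
move=> L0; elim: d c B => [|d ih] c B.
  by rewrite pvol0 => _; rewrite lee_fin lern1 leq_b1.
change 'M[R]_(1 + d, k) in B; rewrite -(vsubmxK B).
move: (usubmx B) (dsubmx B) => u D {B} dP.
have dS := diam_le_slice dP.
have [a ha] : exists a, forall t, (exists y, polyh (c + t *: u) D y) ->
    a <= t <= a + L.
  by apply: diam_sub_itv => // s t [y hy] [z hz]; have [] := dS _ _ _ _ hy hz.
rewrite pvol_col exprSr; apply: (@integral_bound_itv _ a) => //.
- exact: exprn_ge0.
- exact: measurable_pvol_line.
- move=> t; rewrite pvol_ge0 /=; apply: ih => y z hy hz.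
  by have [] := dS _ _ _ _ hy hz.
- move=> t; apply: contraNeq => h; apply: ha; apply: contrapT => hn.
  by move/eqP: h; apply; apply: pvol_empty => y hy; apply: hn; exists y.
Qed.

End volume.

(** * Counting lattice points by sections *)

Section boxes.

Definition int_rng (M : nat) : seq int :=
  [seq i%:Z - M%:Z | i <- iota 0 (M + M).+1].

Lemma mem_int_rng M (t : int) : (t \in int_rng M) = (`|t| <= M%:Z).
Proof.
apply/mapP/idP => [[i]|].
  by rewrite mem_iota => h ->; rewrite ler_norml; lia.
rewrite ler_norml => h; exists `|(t + M%:Z)%R|%N; last by lia.
by rewrite mem_iota; lia.
Qed.

Lemma int_rng_uniq M : uniq (int_rng M).
Proof. by rewrite map_inj_uniq ?iota_uniq // => i j; lia. Qed.

Fixpoint int_box (M d : nat) : seq 'rV[int]_d :=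
  if d is d'.+1 then
    [seq row_mx (t%:M : 'M[int]_1) y | t <- int_rng M, y <- int_box M d']
  else [:: 0].

Lemma row_mx_scalarK d (y : 'rV[int]_(1 + d)) :
  row_mx ((y 0 0)%:M : 'M[int]_1) (rsubmx y) = y.
Proof.
rewrite -[RHS]hsubmxK; congr row_mx; rewrite [RHS]mx11_scalar mxE.
by congr (y _ _)%:M; apply: val_inj.
Qed.

Lemma mem_int_box M d (y : 'rV[int]_d) :
  (y \in int_box M d) = [forall j, `|y 0 j| <= M%:Z].
Proof.
elim: d y => [|d ih] y; first by rewrite [y]thinmx0 inE eqxx; apply/esym/forallP => -[].
change 'rV[int]_(1 + d) in y; apply/allpairsP/forallP.
  move=> [[t z] /= [tM]]; rewrite ih => /forallP zM -> j.
  rewrite mxE; case: splitP => i _; last exact: zM.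
  by rewrite ord1 !mxE eqxx mulr1n -mem_int_rng.
move=> h; exists (y 0 0, rsubmx y); split; last by rewrite row_mx_scalarK.
  by rewrite mem_int_rng; exact: (h ord0).
by rewrite [_ \in _]ih; apply/forallP => j; rewrite mxE; exact: h.
Qed.

Lemma int_box_uniq M d : uniq (int_box M d).
Proof.
elim: d => [//|d ih]; apply: (@allpairs_uniq _ _ _ (fun t (y : 'rV[int]_d) => row_mx (t%:M : 'M[int]_1) y)) => //.
  exact: int_rng_uniq.
move=> [t y] [s z] _ _ /= /eq_row_mx[ts ->]; congr (_, _).
by have := congr1 (fun M : 'M[int]_1 => M 0 0) ts; rewrite !mxE eqxx !mulr1n.
Qed.

(** Reduction of all coordinates modulo [L + 1] is injective on [s]: congruent integers at distance
    at most [L] are equal. *)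
Lemma size_int_diam d (L : nat) (s : seq 'rV[int]_d) : uniq s ->
  (forall y z, y \in s -> z \in s -> forall j, `|y 0 j - z 0 j| <= L%:Z) ->
  (size s <= L.+1 ^ d)%N.
Proof.
move=> us sL.
pose phi (y : 'rV[int]_d) : {ffun 'I_d -> 'I_L.+1} :=
  [ffun j => inord `|(y 0%R j %% L.+1%:Z)%Z|%N].
have phi_inj : {in s &, injective phi}.
  move=> y z ys zs /ffunP e; apply/rowP => j.
  have := sL _ _ ys zs j; have := e j; rewrite !ffunE => /(congr1 val) /=.
  have lt (a : int) : (`|(a %% L.+1%:Z)%Z| < L.+1)%N.
    by have := ltz_pmod a (isT : 0 < L.+1%:Z); have := modz_ge0 a (isT : L.+1%:Z != 0); lia.
  rewrite !inordK // => h.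
  have {}h : (y 0%R j = z 0%R j %[mod L.+1%:Z])%Z.
    have := modz_ge0 (y 0 j) (isT : L.+1%:Z != 0).
    by have := modz_ge0 (z 0 j) (isT : L.+1%:Z != 0); lia.
  move/eqP: h; rewrite eqz_mod_dvd => /dvdzP[q hq]; rewrite hq ler_norml => hL.
  have q0 : q = 0 by nia.
  by move: hq; rewrite q0 mul0r => /eqP; rewrite subr_eq0 => /eqP.
have /card_uniqP us' : uniq [seq phi y | y <- s] by rewrite map_inj_in_uniq.
rewrite -(size_map phi) -us'; apply: leq_trans (max_card _) _.
by rewrite card_ffun !card_ord.
Qed.

End boxes.

(** * Lattice points against volume *)

Section davenport.
Variable R : realType.
Local Notation mu := (@lebesgue_measure R).

(** The endpoints may or may not belong to [I]: the upper bound counts integers in the closed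
    interval from inf to sup, the lower bound those in the open one, and both intervals have the
    length of [I]. *)
Lemma count_itv (M : nat) (I : set R) : is_interval I ->
  (forall t, I t -> `|t| <= M%:R) -> I !=set0 ->
  `|\sum_(t <- int_rng M) (`[< I t%:~R >])%:R - fine (mu I)| <= 1.
Proof.
move=> iI IM I0; have [x0 Ix0] := I0.
have ubI : has_ubound I by exists M%:R => t /IM; rewrite ler_norml => /andP[].
have lbI : has_lbound I by exists (- M%:R) => t /IM; rewrite ler_norml => /andP[].
set a := inf I; set b := sup I.
have Iab t : I t -> a <= t <= b.
  by move=> It; rewrite ge_inf //= ub_le_sup.
have abI t : a < t < b -> I t.
  move=> /andP[at_ tb].
  have [y Iy yt] := inf_lt I0 at_; have [z Iz tz] := sup_gt I0 tb.
  by apply: (iI y z) => //; rewrite !ltW.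
have ab : a <= b by have /andP[] := Iab _ Ix0; exact: le_trans.
have mI : measurable I by exact: is_interval_measurable.
have muI : mu I = (b - a)%:E.
  have -> : (b - a)%:E = mu `[a, b].
    rewrite lebesgue_measure_itv /= lte_fin; case: ltgtP ab => // e _.
    by rewrite e subrr.
  apply/eqP; rewrite eq_le; apply/andP; split.
    by apply: le_measure; rewrite ?inE // => t /Iab; rewrite /= in_itv.
  have -> : mu `[a, b] = mu `]a, b[ by rewrite !lebesgue_measure_itv.
  by apply: le_measure; rewrite ?inE // => t; rewrite /= in_itv /=; exact: abI.
rewrite muI /=.
have -> : \sum_(t <- int_rng M) (`[< I t%:~R >])%:R =
    (size [seq t <- int_rng M | `[< I t%:~R >]])%:R :> R.
  rewrite size_filter -sum1_count natr_sum [RHS]big_mkcond /=.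
  by apply: eq_bigr => t _; case: ifP.
set s := [seq t <- _ | _].
have us : uniq s by rewrite filter_uniq ?int_rng_uniq.
have ms t : (t \in s) = `[< I t%:~R >].
  rewrite mem_filter mem_int_rng andb_idr // => /asboolP /IM.
  by rewrite -intr_norm [M%:R]pmulrn ler_int.
have natE (z : int) : 0 <= z -> (`|z|%N%:R : R) = z%:~R.
  by move=> z0; rewrite pmulrn gez0_abs.
have seg_size (z : int) (n : nat) : size [seq z + i%:Z | i <- iota 0 n] = n.
  by rewrite size_map size_iota.
have ceilE (x : R) (z : int) : (x <= z%:~R) = (Num.ceil x <= z).
  by rewrite ceil_le_int.
have floorE (x : R) (z : int) : (z%:~R <= x) = (z <= Num.floor x).
  by rewrite floor_ge_int.
have ltceilE (x : R) (z : int) : (z%:~R < x) = (z < Num.ceil x).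
  by rewrite ceil_gt_int.
have ltfloorE (x : R) (z : int) : (x < z%:~R) = (Num.floor x < z).
  by rewrite floor_lt_int.
have upper : (size s)%:R <= b - a + 1.
  have [n0|n0] := leP 0 (Num.floor b - Num.ceil a + 1); last first.
    suff -> : size s = 0%N by rewrite addr_ge0 // subr_ge0.
    apply/eqP; rewrite -leqn0 leqNgt -has_predT.
    apply/negP => /hasP[t]; rewrite ms => /asboolP /Iab /andP[].
    by rewrite ceilE floorE => ? ? _; lia.
  have : (size s <= `|(Num.floor b - Num.ceil a + 1)%R|)%N.
    rewrite -[X in (_ <= X)%N](seg_size (Num.ceil a)); apply: uniq_leq_size => //.
    move=> t; rewrite ms => /asboolP /Iab; rewrite ceilE floorE => h.
    by apply/mapP; exists `|(t - Num.ceil a)%R|%N; [rewrite mem_iota|]; lia.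
  rewrite -(ler_nat R) natE // => /le_trans; apply.
  rewrite !rmorphD /= rmorphN /= lerD2r; apply: lerB; first exact: floor_le.
  exact: ceil_ge.
have lower : b - a - 1 <= (size s)%:R.
  have ca : (Num.floor a)%:~R <= a by exact: floor_le.
  have fb : b <= (Num.ceil b)%:~R by exact: ceil_ge.
  have [n0|n0] := leP 0 (Num.ceil b - Num.floor a - 1); last first.
    apply: (@le_trans _ _ 0) => //; move: n0; rewrite -(@ltrz0 R).
    by rewrite !rmorphD /= !rmorphN /=; lra.
  have : (`|(Num.ceil b - Num.floor a - 1)%R| <= size s)%N.
    rewrite -[X in (X <= _)%N](seg_size (Num.floor a + 1)); apply: uniq_leq_size.
      by rewrite map_inj_uniq ?iota_uniq // => i j; lia.
    move=> t /mapP[i]; rewrite mem_iota => hi ti.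
    rewrite ms; apply/asboolP; apply: abI; rewrite ltfloorE ltceilE; lia.
  rewrite -(ler_nat R) natE //; apply: le_trans.
  by rewrite !rmorphD /= !rmorphN /=; lra.
by rewrite ler_norml; lra.
Qed.


(** [M] only makes the sum finite. The error estimate depends on the diameter and not on [M], hence
    not on where the polytope lies. *)
Definition lat_count (M : nat) d k (c : 'rV[R]_k) (B : 'M[R]_(d, k)) : R :=
  \sum_(y <- int_box M d) (`[< polyh c B (map_mx intr y) >])%:R.

Lemma polyh_section_itv d k (c u : 'rV[R]_k) (D : 'M[R]_(d, k)) (y : 'rV[R]_d) :
  is_interval [set t | polyh (c + t *: u) D y].
Proof.
move=> s t /= hs ht r /andP[sr rt] i; move: (hs i) (ht i); rewrite !mxE.
move: (c 0 i) (u 0 i) (\sum__ _) => a b e h1 h2.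
have [b0|b0] := leP 0 b.
  by apply: le_trans h1 _; rewrite lerD2r lerD2l ler_wpM2r.
by apply: le_trans h2 _; rewrite lerD2r lerD2l ler_wnM2r // ltW.
Qed.

(** One-sided, so that it can be applied in both directions without integrating a difference of
    extended reals. *)
Lemma davenport_le (F G : measurableTypeR R -> \bar R) (a L e : R) :
  0 <= L -> 0 <= e -> measurable_fun setT F -> measurable_fun setT G ->
  (forall t, 0 <= F t)%E -> (forall t, 0 <= G t)%E ->
  (forall t, F t <= G t + (e * \1_(`[a, a + L]) t)%:E)%E ->
  (\int[mu]_t F t <= \int[mu]_t G t + (e * L)%:E)%E.
Proof.
move=> L0 e0 mF mG F0 G0 FG.
have mI : measurable_fun setT
    (fun t : measurableTypeR R => (e * \1_(`[a, a + L]) t)%:E).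
  by apply/measurable_EFinP; apply: measurable_funM => //; exact: measurable_indic.
have I0 t : (0 <= (e * \1_(`[a, a + L]) t)%:E)%E by rewrite lee_fin mulr_ge0.
apply: (@le_trans _ _ (\int[mu]_t (G t + (e * \1_(`[a, a + L]) t)%:E))%E).
  by apply: ge0_le_integral => //; exact: emeasurable_funD.
rewrite ge0_integralD //; apply: leeD => //.
apply: (@integral_bound_itv _ _ a) => // t.
  rewrite I0 lee_fin -[leRHS]mulr1 ler_wpM2l // indicE lern1; exact: leq_b1.
rewrite indicE => h; rewrite memNset ?mulr0 //=.
by rewrite in_itv /=; exact/negP.
Qed.

(* Davenport's argument: at fixed last coordinates y, the number of integers t
   with (t, y) in the polyhedron differs from the length of the section by at most
   1; summing over y and exchanging sum and integral leaves the lattice count of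
   the slices at real t, to which induction applies. *)
Lemma lat_count_pvol d k (c : 'rV[R]_k) (B : 'M[R]_(d, k)) (L M : nat) :
  diam_le (polyh c B) L%:R ->
  (forall y, polyh c B y -> forall j, `|y 0 j| <= M%:R) ->
  `|lat_count M c B - fine (pvol c B)| <= (d * L.+1 ^ d.-1)%:R.
Proof.
elim: d c B => [|d ih] c B.
  move=> _ _; rewrite /lat_count big_seq1 pvol0 mul0n /=.
  suff -> : `[< polyh c B (map_mx intr 0) >] = [forall i, 0 <= c 0 i].
    by rewrite subrr normr0.
  apply/asboolP/forallP => h i; have := h i; by rewrite map_mx0 mul0mx addr0.
change 'M[R]_(1 + d, k) in B; rewrite -(vsubmxK B).
move: (usubmx B) (dsubmx B) => u D {B} dP PM.
have dS := diam_le_slice dP.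
have SM t y : polyh (c + t *: u) D y -> `|t| <= M%:R /\ forall j, `|y 0 j| <= M%:R.
  move=> hy; have : polyh c (col_mx u D) (row_mx (t%:M : 'M[R]_1) y).
    by move=> i; have := hy i; rewrite mul_row_col mul_scalar_mx addrA.
  move=> /PM h; split=> [|j].
    by have := h (lshift d (0 : 'I_1)); rewrite (@row_mxEl _ 1 1 d) mxE eqxx mulr1n.
  by have := h (rshift 1 j); rewrite (@row_mxEr _ 1 1 d).
have [a ha] : exists a, forall t, (exists y, polyh (c + t *: u) D y) ->
    a <= t <= a + L%:R.
  by apply: diam_sub_itv => // s t [y hy] [z hz]; have [] := dS _ _ _ _ hy hz.
have L0 : 0 <= L%:R :> R by [].
have Ffin t : pvol (c + t *: u) D = (fine (pvol (c + t *: u) D))%:E.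
  rewrite fineK // ge0_fin_numE ?pvol_ge0 //.
  apply: le_lt_trans (ltry (L%:R ^+ d)); apply: pvol_diam => // y z hy hz j.
  by have [_] := dS _ _ _ _ hy hz; exact.
have ihS t : `|lat_count M (c + t *: u) D - fine (pvol (c + t *: u) D)| <=
    (d * L.+1 ^ d.-1)%:R.
  apply: ih => [y z hy hz j|y hy j].
    by have [_] := dS _ _ _ _ hy hz; exact.
  by have [_] := SM _ _ hy; exact.
pose S (y : 'rV[int]_d) : set R := [set t | polyh (c + t *: u) D (map_mx intr y)].
have mS y : measurable (S y).
  by apply: is_interval_measurable; exact: polyh_section_itv.
have NE t : lat_count M (c + t *: u) D = \sum_(y <- int_box M d) \1_(S y) t.
  by apply: eq_bigr => y _; rewrite indicE; congr (nat_of_bool _)%:R;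
    apply/asboolP/idP; rewrite inE.
pose V := fine (pvol c (col_mx u D)).
pose W := \sum_(y <- int_box M d) fine (mu (S y)).
have muS y : mu (S y) = (fine (mu (S y)))%:E.
  rewrite fineK // ge0_fin_numE //.
  apply: (@le_lt_trans _ _ (mu `[- M%:R, M%:R])).
    apply: le_measure; rewrite ?inE //=; first exact: mS.
    by move=> t /SM[] /=; rewrite in_itv /= -ler_norml.
  by rewrite lebesgue_measure_itv /= lte_fin; case: ifP; rewrite ?ltry.
have intN : (\int[mu]_t (lat_count M (c + t *: u) D)%:E = W%:E)%E.
  under eq_integral do rewrite NE -sumEFin.
  rewrite ge0_integral_sum //; last first.
    by move=> y; apply/measurable_EFinP; apply: measurable_indic; exact: mS.
  rewrite /W -sumEFin; apply: eq_bigr => y _.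
  by rewrite integral_indic ?setIT -?muS //; exact: mS.
have intF : (\int[mu]_t pvol (c + t *: u) D = V%:E)%E.
  rewrite /V -pvol_col fineK // ge0_fin_numE ?pvol_ge0 //.
  by apply: le_lt_trans (ltry (L%:R ^+ (1 + d))); exact: pvol_diam.
have mN : measurable_fun [set: measurableTypeR R]
    (fun t => (lat_count M (c + t *: u) D)%:E).
  apply/measurable_EFinP; under eq_fun do rewrite NE.
  by apply: measurable_sum => y; apply: measurable_indic; exact: mS.
have N0 t : (0 <= (lat_count M (c + t *: u) D)%:E)%E.
  by rewrite lee_fin /lat_count; apply: sumr_ge0.
pose e : R := (d * L.+1 ^ d.-1)%:R.
have outside t : ~~ (a <= t <= a + L%:R) ->
    lat_count M (c + t *: u) D = 0 /\ fine (pvol (c + t *: u) D) = 0.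
  move=> ht; have h y : ~ polyh (c + t *: u) D y.
    by move=> hy; move/negP: ht; apply; apply: ha; exists y.
  rewrite pvol_empty //; split => //; rewrite /lat_count big1 // => y _.
  by case: asboolP => // /h.
have ptw t : `|lat_count M (c + t *: u) D - fine (pvol (c + t *: u) D)| <=
    e * \1_(`[a, a + L%:R]) t.
  rewrite indicE; have [h|h] := boolP (a <= t <= a + L%:R).
    by rewrite mem_set /= ?in_itv // mulr1.
  by have [-> ->] := outside _ h; rewrite subr0 normr0 mulr_ge0 /e.
have VW : `|W - V| <= e * L%:R.
  rewrite ler_norml; apply/andP; split.
    rewrite lerBrDr addrC lerBlDr -lee_fin EFinD -intF -intN.
    apply: (@davenport_le _ _ a) => //; rewrite /e //.
    - exact: measurable_pvol_line.
    - by move=> t; exact: pvol_ge0.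
    move=> t; rewrite Ffin -EFinD lee_fin; have := ptw t.
    by rewrite ler_norml; lra.
  rewrite lerBlDr addrC -lee_fin EFinD -intF -intN.
  apply: (@davenport_le _ _ a) => //; rewrite /e //.
  - exact: measurable_pvol_line.
  - by move=> t; exact: pvol_ge0.
  move=> t; rewrite Ffin -EFinD lee_fin; have := ptw t.
  by rewrite ler_norml; lra.
have NW : `|lat_count M c (col_mx u D) - W| <= (L.+1 ^ d)%:R.
  have -> : lat_count M c (col_mx u D) =
      \sum_(y <- int_box M d) \sum_(t <- int_rng M) (`[< S y t%:~R >])%:R.
    rewrite exchange_big /= /lat_count [LHS]big_allpairs_dep.
    apply: eq_bigr => t _; apply: eq_bigr => y _; congr (nat_of_bool _)%:R.
    apply/asboolP/asboolP => h i; have := h i;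
      by rewrite map_row_mx map_scalar_mx mul_row_col mul_scalar_mx addrA.
  rewrite /W -sumrB; apply: le_trans (ler_norm_sum _ _ _) _.
  (* Only nonempty sections contribute, each at most 1. Their base points have coordinatewise
     diameter at most [L], so there are at most [L.+1 ^ d] of them. *)
  apply: (@le_trans _ _ (\sum_(y <- int_box M d) (`[< S y !=set0 >])%:R)).
    apply: ler_sum => y _; case: asboolP => [Sy|Sy].
      apply: count_itv => //; first exact: polyh_section_itv.
      by move=> t /SM[].
    rewrite (_ : S y = set0) ?measure0; last first.
      by apply/eqP/negPn/negP => /set0P.
    by rewrite big1 ?subr0 ?normr0 // => t _; case: asboolP.
  have -> : \sum_(y <- int_box M d) (`[< S y !=set0 >])%:R =
      (size [seq y <- int_box M d | `[< S y !=set0 >]])%:R :> R.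
    rewrite size_filter -sum1_count natr_sum [RHS]big_mkcond /=.
    by apply: eq_bigr => t _; case: ifP.
  rewrite ler_nat; apply: size_int_diam; first by rewrite filter_uniq ?int_box_uniq.
  move=> y z; rewrite !mem_filter => /andP[/asboolP[s hs] _] /andP[/asboolP[t ht] _] j.
  have [_ /(_ j)] := dS _ _ _ _ hs ht.
  by rewrite !mxE -intrB -intr_norm [L%:R]pmulrn ler_int.
rewrite -/V; have -> : lat_count M c (col_mx u D) - V =
  (lat_count M c (col_mx u D) - W) + (W - V) by rewrite addrA subrK.
apply: le_trans (ler_normD _ _) _; apply: le_trans (lerD NW VW) _.
(* The recursion satisfied by the error term: [L.+1 ^ d + d * L.+1 ^ d.-1 * L <= d.+1 * L.+1 ^
   d]. *)
rewrite /e -natrM -natrD ler_nat /=.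
case: d {ih dS D dP PM SM ha Ffin ihS S mS NE V W muS intN intF mN N0 e outside ptw VW NW} => [|d] //=.
rewrite expnS; nia.
Qed.

End davenport.

(** * Reduced lattice bases *)

Section lattice_basis.
Variable R : realType.

(* The rows of H are a basis of La; x *m P reads off coordinates in this basis
   and extends them to all of R^k, with a norm that does not depend on La. *)
Definition reduced_basis k (La : 'rV[int]_k -> Prop) d (H : 'M[int]_(d, k))
    (P : 'M[R]_(k, d)) :=
  [/\ forall x, La x <-> exists y, x = y *m H,
      map_mx intr H *m P = 1%:M &
      forall (x : 'rV[R]_k) (M : R), (forall i, `|x 0 i| <= M) ->
        forall j, `|(x *m P) 0 j| <= d%:R * M].

(* A vector with the least positive first entry is added to a basis of the vectors
   with first entry 0, after subtracting the integer parts of its coordinates. *)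
Lemma lattice_basis_step k (La : 'rV[int]_(1 + k) -> Prop) d
    (H : 'M[int]_(d, k)) (P : 'M[R]_(k, d)) :
  La 0 -> (forall (a : int) x y, La x -> La y -> La (a *: x + y)) ->
  reduced_basis (fun x => La (row_mx 0 x)) H P ->
  exists d', exists H' : 'M[int]_(d', 1 + k), exists P' : 'M[R]_(1 + k, d'),
    reduced_basis La H' P'.
Proof.
move=> La0 LaD [HL HP PM].
have La_mul (a : int) x : La x -> La (a *: x).
  by move=> hx; rewrite -[_ *: _]addr0; apply: LaD.
have La_D x y : La x -> La y -> La (x + y).
  by move=> hx hy; rewrite -[x]scale1r; apply: LaD.
have LaH (y : 'rV[int]_d) : La (row_mx 0 (y *m H)).
  by have := HL (y *m H); move=> [_]; apply; exists y.
have lsub (x : 'rV[int]_(1 + k)) : lsubmx x = (x 0 0)%:M.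
  rewrite [LHS]mx11_scalar mxE; congr (x _ _)%:M; exact: val_inj.
have [hpos|hzero] := pselect (exists x, La x /\ x 0 0 <> 0); last first.
  have x00 (x : 'rV[int]_(1 + k)) : La x -> lsubmx x = 0.
    move=> Lx; rewrite lsub; suff -> : x 0 0 = 0 by rewrite raddf0.
    by apply: contrapT => h; apply: hzero; exists x.
  exists d, (row_mx 0 H), (col_mx 0 P); split.
  - move=> x; split=> [Lx|[y ->]]; last by rewrite mul_mx_row mulmx0.
    have := Lx; rewrite -{1}(hsubmxK x) (x00 _ Lx) HL => -[y yx].
    by exists y; rewrite mul_mx_row mulmx0 -yx -{1}(hsubmxK x) x00.
  - by rewrite map_row_mx mul_row_col mulmx0 add0r.
  - move=> x M xM j; rewrite -(hsubmxK x) mul_row_col mulmx0 add0r.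
    by apply: PM => i; rewrite mxE.
have hexP : exists n : nat, `[< (0 < n)%N /\ exists x, La x /\ x 0 0 = n%:Z >].
  case: hpos => x [Lx x0]; exists `|x 0%R 0%R|%N; apply/asboolP; split.
    by rewrite absz_gt0; apply/eqP.
  exists (Num.sg (x 0 0) *: x); split; first exact: La_mul.
  by rewrite mxE abszE -normrEsg.
case: (ex_minnP hexP) => h /asboolP[h0 [r0 [Lr r0h]]] hmin.
have hZ : h%:Z != 0 by rewrite gt_eqF.
have hR : h%:R != 0 :> R by rewrite pnatr_eq0 -lt0n.
pose s := rsubmx r0.
pose sP := map_mx intr s *m P.
pose z : 'rV[int]_d := map_mx (fun x : R => Num.floor x) sP.
pose r := s - z *m H.
have Lhr : La (row_mx h%:Z%:M r).
  have -> : row_mx h%:Z%:M r = r0 + (-1) *: row_mx 0 (z *m H).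
    rewrite -[r0 in RHS]hsubmxK lsub r0h scale_row_mx add_row_mx scaler0 addr0.
    by rewrite scaleN1r.
  by apply: La_D => //; exact: La_mul.
have rP j : `|(map_mx intr r *m P) 0 j| <= 1.
  rewrite /r map_mxB map_mxM mulmxBl -mulmxA HP mulmx1 -/sP.
  have -> : (sP - map_mx intr z) 0 j = sP 0 j - (Num.floor (sP 0 j))%:~R.
    by rewrite mxE; congr (_ + _); rewrite 2!mxE; congr (- _%:~R); rewrite mxE.
  have /andP[] := floor_itv (sP 0 j).
  by rewrite intrD ler_norml; lra.
have first_dvd x : La x -> exists q, x 0 0 = q * h%:Z.
  move=> Lx; exists (x 0%R 0%R %/ h%:Z)%Z.
  have xE := divz_eq (x 0 0) h%:Z; rewrite {1}xE.
  suff -> : (x 0%R 0%R %% h%:Z)%Z = 0 by rewrite addr0.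
  apply/eqP/negPn/negP => m0.
  have m_ge := modz_ge0 (x 0 0) hZ.
  have m_lt : (x 0%R 0%R %% h%:Z)%Z < h%:Z by rewrite ltz_pmod.
  have : (h <= `|(x 0%R 0%R %% h%:Z)%Z|)%N.
    apply: hmin; apply/asboolP; split; first by rewrite absz_gt0.
    exists (x + (- (x 0%R 0%R %/ h%:Z)%Z) *: row_mx h%:Z%:M r); split.
      by apply: La_D => //; exact: La_mul.
    rewrite gez0_abs // mxE [X in _ + X]mxE {1}xE.
    have -> : (row_mx h%:Z%:M r : 'rV[int]_(1 + k)) 0 0 = h%:Z.
      rewrite (_ : (0 : 'I_(1 + k)) = lshift k 0); last exact: val_inj.
      by rewrite row_mxEl mxE eqxx mulr1n.
    by rewrite mulNr addrAC subrr add0r.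
  by rewrite leqNgt -ltz_nat gez0_abs // m_lt.
(* The new coordinates of [(x0, x')] are [x0 / h] and [(x' - (x0 / h) r) *m P]. The entries of
   [r *m P] are at most 1 in absolute value and [h >= 1], so the norm bound grows only from [d] to
   [1 + d]. *)
exists (1 + d)%N, (block_mx h%:Z%:M r 0 H),
  (block_mx (h%:R^-1)%:M (- h%:R^-1 *: (map_mx intr r *m P)) 0 P); split.
- move=> x; split=> [Lx|[y ->]].
    have [q xq] := first_dvd _ Lx.
    have := La_D _ _ Lx (La_mul (- q) _ Lhr).
    rewrite -[x in x + _]hsubmxK lsub xq scale_row_mx add_row_mx scale_scalar_mx.
    rewrite -raddfD /= mulNr subrr raddf0 HL => -[y yx].
    exists (row_mx q%:M y); rewrite mul_row_block mulmx0 addr0 -yx.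
    rewrite -[LHS]hsubmxK lsub xq !mul_scalar_mx scale_scalar_mx.
    by rewrite scaleNr addrC subrK.
  rewrite -(hsubmxK y) mul_row_block mulmx0 addr0.
  rewrite (mx11_scalar (lsubmx y)) !mul_scalar_mx.
  rewrite -[X in row_mx X _]addr0 -add_row_mx -scale_row_mx.
  by apply: LaD.
- rewrite map_block_mx mulmx_block map_scalar_mx !mul_scalar_mx.
  rewrite mulmx0 addr0 scale_scalar_mx.
  have -> : map_mx intr (0 : 'M[int]_(d, 1)) = 0 :> 'M[R]_(d, 1).
    by apply/matrixP => i j; rewrite !mxE.
  rewrite !mul0mx !mulmx0 !add0r HP scalerA /= -pmulrn mulrN mulfV // scaleN1r.
  by rewrite addNr -scalar_mx_block.
- move=> x M xM j.
  have M0 : 0 <= M by apply: le_trans (xM 0).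
  rewrite -(hsubmxK x) mul_row_block mulmx0 addr0.
  have x0E : lsubmx x = (x 0 0)%:M.
    by rewrite [LHS]mx11_scalar mxE; congr (x _ _)%:M; exact: val_inj.
  rewrite x0E !mul_scalar_mx scale_scalar_mx.
  have x0M : `|x 0 0 / h%:R| <= M.
    rewrite normrM normfV normr_nat ler_pdivrMr ?ltr0n //.
    by apply: le_trans (xM 0) _; rewrite ler_peMr // ler1n.
  rewrite mxE; case: splitP => i _.
    rewrite ord1 mxE eqxx mulr1n; apply: le_trans x0M _.
    by rewrite ler_peMl // ler1n.
  rewrite mxE; apply: le_trans (ler_normD _ _) _.
  rewrite natrD mulrDl mul1r; apply: lerD; last first.
    by apply: PM => l; rewrite mxE.
  rewrite scalerA mxE normrM mulrN normrN -[leRHS]mulr1.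
  by apply: ler_pM.
Qed.

Lemma lattice_basis k (La : 'rV[int]_k -> Prop) :
  La 0 -> (forall (a : int) x y, La x -> La y -> La (a *: x + y)) ->
  exists d, exists H : 'M[int]_(d, k), exists P : 'M[R]_(k, d),
    reduced_basis La H P.
Proof.
elim: k La => [|k ih] La La0 LaD.
  exists 0%N, 0, 0; split=> [x||x M _ []] //; last by rewrite [LHS]flatmx0 [RHS]flatmx0.
  split=> [_|_]; last by rewrite [x]thinmx0.
  by exists 0; rewrite [LHS]thinmx0 [RHS]thinmx0.
have [||d [H [P HP]]] := ih (fun x => La (row_mx (0 : 'M[int]_1) x)).
- by rewrite row_mx0.
- move=> a x y hx hy.
  by have := LaD a _ _ hx hy; rewrite (@scale_row_mx _ 1 1 k) (@add_row_mx _ 1 1 k) scaler0 addr0.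
exact: (@lattice_basis_step k La d H P).
Qed.

End lattice_basis.

(** * The truncated power in an arbitrary basis of the kernel *)

Section trunc_power.
Variable R : realType.

(** True for infinite [x] as well, since [fine] sends it to 0; scalars can thus be extracted before
    any volume is known to be finite. *)
Lemma fine_EFinM (r : R) (x : \bar R) : 0 <= r -> fine (r%:E * x) = r * fine x.
Proof.
rewrite le_eqVlt => /predU1P[<-|r0]; first by rewrite mul0e mul0r.
by case: x => [x||] //=; rewrite ?gt0_muley ?gt0_muleNy ?lte_fin // mulr0.
Qed.

Lemma rowmx_norm0 k (x : 'rV[R]_k) : x *m x^T = 0 -> x = 0.
Proof.
move=> /matrixP/(_ 0 0); rewrite !mxE => /eqP; rewrite psumr_eq0 => [|i _].
  move=> /allP h; apply/rowP => i; have := h i (mem_index_enum i).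
  by rewrite !mxE mulf_eq0 orbb => /eqP.
by rewrite mxE -expr2 sqr_ge0.
Qed.

Lemma rowmx_norm_ge0 k (x : 'rV[R]_k) : 0 <= (x *m x^T) 0 0.
Proof. by rewrite mxE; apply: sumr_ge0 => i _; rewrite mxE -expr2 sqr_ge0. Qed.

Section adapted_basis.
Variable d : nat.
Variables (A N : 'M[R]_(2, 2 + d)) (B : 'M[R]_(d, 2 + d)).
Hypothesis NA : N *m A^T = 1%:M.
Hypothesis BA : B *m A^T = 0.
Hypothesis detW : \det (col_mx N B) != 0.

(** [N] is dual to the rows of [A] and [B] spans the kernel, so the rows of [W] form a basis in
    which multiplication by [A^T] reads off the [N]-coordinates. *)
Let W := col_mx N B.

Let unitW : W \in unitmx. Proof. by rewrite unitmxE unitfE. Qed.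

Lemma kernel_coords e (X : 'M[R]_(e, 2 + d)) : X *m A^T = 0 ->
  exists G : 'M[R]_(e, d), X = G *m B.
Proof.
move=> XA; exists (rsubmx (X *m invmx W)).
have := mulmxKV unitW X; rewrite -{1}(hsubmxK (X *m invmx W)) mul_row_col => XE.
have l0 : lsubmx (X *m invmx W) = 0.
  by have := congr1 (mulmx^~ A^T) XE; rewrite mulmxDl -!mulmxA NA BA mulmx1 mulmx0 addr0 XA.
by rewrite -[LHS]XE l0 mul0mx add0r.
Qed.

Lemma rank_kernel : \rank (kermx A^T) = d.
Proof.
rewrite mxrank_ker (_ : \rank A^T = 2%N) ?addKn //.
apply/eqP; rewrite eqn_leq; apply/andP; split; first by rewrite rank_leq_col.
by have := mxrankM_maxr N A^T; rewrite NA mxrank1.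
Qed.

(** Compare the completions of [B] by [N] and by [A], called [W] and [M]: [W *m M^T] is block
    triangular, and [M *m M^T] is block diagonal because the kernel is orthogonal to the rows of
    [A]. Cancelling [\det M] gives [\det M = \det (A *m A^T) * \det W]. *)
Lemma gram_det : \det (B *m B^T) = \det W ^+ 2 * \det (A *m A^T).
Proof.
pose M := col_mx A B.
have AB : A *m B^T = 0 by rewrite -[LHS]trmxK trmx_mul trmxK BA trmx0.
have WM : \det W * \det M = \det (B *m B^T).
  rewrite -(det_tr M) -det_mulmx /M tr_col_mx mul_col_row NA BA.
  by rewrite det_ublock det1 mul1r.
have MM : \det M ^+ 2 = \det (A *m A^T) * \det (B *m B^T).
  rewrite expr2 -{2}(det_tr M) -det_mulmx /M tr_col_mx mul_col_row AB BA.
  by rewrite det_lblock.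
have M0 : \det M != 0.
  rewrite -unitfE -det_tr -unitmxE -row_free_unit; apply: inj_row_free => x.
  rewrite tr_col_mx mul_mx_row => /eqP; rewrite row_mx_eq0 => /andP[/eqP xA /eqP xB].
  have [u xu] := kernel_coords xA.
  by apply: rowmx_norm0; rewrite {2}xu trmx_mul mulmxA xB mul0mx.
have : \det M * (\det M - \det (A *m A^T) * \det W) = 0.
  by rewrite mulrBr -expr2 MM -WM; ring.
move/eqP; rewrite mulf_eq0 (negbTE M0) /= subr_eq0 => /eqP ME.
by rewrite -WM ME; ring.
Qed.

Lemma det_gram_neq0 : \det (A *m A^T) != 0.
Proof.
rewrite -unitfE -unitmxE -row_free_unit; apply: inj_row_free => x xA.
have : x *m A = 0.
  by apply: rowmx_norm0; rewrite trmx_mul mulmxA -(mulmxA x) xA mul0mx.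
move=> /(congr1 (fun y => y *m N^T)).
by rewrite mul0mx -mulmxA -[A *m N^T]trmxK trmx_mul trmxK NA trmx1 mulmx1.
Qed.

(** For rows [r] and [s] with [r] nonzero, the determinant is [|r|^2 |v|^2], where [v] is the
    component of [s] orthogonal to [r] (Gram-Schmidt). *)
Lemma det_gram_gt0 : 0 < \det (A *m A^T).
Proof.
rewrite lt_neqAle eq_sym det_gram_neq0 /=; have := det_gram_neq0.
suff key (X : 'M[R]_(1 + 1, 2 + d)) : \det (X *m X^T) != 0 ->
  0 <= \det (X *m X^T) by exact: key.
rewrite -(vsubmxK X) tr_col_mx mul_col_row.
move: (usubmx _) (dsubmx _) => r s; rewrite (mx11_scalar (r *m r^T)).
have [a0|a0] := eqVneq ((r *m r^T) 0 0) 0.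
  have r0 : r = 0 by apply: rowmx_norm0; rewrite [LHS]mx11_scalar a0 raddf0.
  by rewrite r0 !mul0mx raddf0 mxE raddf0 det_lblock det0 mul0r eqxx.
rewrite det_block1 // => _; set a := (r *m r^T) 0 0 in a0 *.
have aE : r *m r^T = a%:M by rewrite [LHS]mx11_scalar.
apply: mulr_ge0; first exact: rowmx_norm_ge0.
pose v := s - a^-1 *: (s *m r^T) *m r.
have vr : v *m r^T = 0.
  by rewrite mulmxBl -mulmxA aE mul_mx_scalar scalerA mulfV // scale1r subrr.
suff -> : s *m s^T - a^-1 *: (s *m r^T *m (r *m s^T)) = v *m v^T.
  by rewrite det_mx11 rowmx_norm_ge0.
rewrite [v^T]linearB /= trmx_mul mulmxBr [v *m (_ *m _)]mulmxA vr mul0mx subr0 mulmxBl.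
by rewrite -!scalemxAl !mulmxA.
Qed.

(** The basis used by [trunc_power] is [G *m B] for an invertible [G]. By [gram_det] the root of its
    Gram determinant is [|det G| |det W|] times the root of [\det (A *m A^T)]: the last factor
    cancels the normalization, and [|det G|] is the Jacobian of the change of basis. Replacing the
    base point by [p] is a translation. *)
Lemma trunc_power_basis (p : 'rV[R]_(2 + d)) (b : 'cV[R]_2) :
  p *m A^T = b^T -> trunc_power A b = `|\det W| * fine (pvol p B).
Proof.
move=> pA; rewrite /trunc_power /flat_vol.
set p0 := b^T *m pinvmx A^T.
have p0A : p0 *m A^T = b^T by rewrite mulmxKpV // -pA submxMl.
have kA : row_base (kermx A^T) *m A^T = 0.
  by apply/sub_kermxP; rewrite eq_row_base.
have := row_base_free (kermx A^T); move: kA; move: (row_base _).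
rewrite rank_kernel => B0 B0A B0free.
have [G GE] := kernel_coords B0A.
have unitG : G \in unitmx.
  rewrite -row_free_unit -row_leq_rank -[X in (X <= _)%N](eqP B0free) GE.
  exact: mxrankM_maxl.
have [u uE] : exists u, p0 - p = u *m B.
  by apply: kernel_coords; rewrite mulmxBl p0A pA subrr.
have -> : [set y : 'rV[R]_d | [set x : 'rV_(2 + d) | (forall i, 0 <= x 0 i) /\
    A *m x^T = b] (p0 + y *m B0)] = polyh p0 B0.
  apply/seteqP; split => y /=; first by case.
  move=> h; split => //.
  apply: trmx_inj; rewrite trmx_mul trmxK mulmxDl -[y *m _ *m _]mulmxA B0A.
  by rewrite mulmx0 addr0.
rewrite -/(pvol p0 B0) GE.
have -> : \det (G *m B *m (G *m B)^T) = (\det G * \det W) ^+ 2 * \det (A *m A^T).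
  rewrite trmx_mul !mulmxA -(mulmxA G) !det_mulmx det_tr exprMn -[RHS]mulrA -gram_det.
  by ring.
rewrite sqrtrM ?sqr_ge0 // sqrtr_sqr normrM fine_EFinM; last by rewrite !mulr_ge0.
rewrite -(pvol_unit p B unitG) fine_EFinM //.
rewrite -[p0](subrK p) uE addrC.
have -> : pvol (p + u *m B) (G *m B) = pvol p (G *m B).
  by rewrite -(pvol_shift p (G *m B) (u *m invmx G)) mulmxA mulmxKV.
have s0 : Num.sqrt (\det (A *m A^T)) != 0 by rewrite gt_eqF // sqrtr_gt0 det_gram_gt0.
by field.
Qed.
End adapted_basis.
End trunc_power.

(** * Nonnegative integer solutions as lattice points of a polytope *)

Section lattice_points.
Variable R : realType.

Local Notation rmx := (map_mx (intr : int -> R)).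

(** The rows of [N] are preimages of the unit vectors. The rows of [1%:M - A^T *m N] lie in the
    kernel lattice, so this matrix is [Y *m H] with [Y] integral. Then [row_mx A^T Y] is a two-sided
    integral inverse of [col_mx N H], which forces both the number of rows of [H] and the
    determinant. *)
Lemma kernel_lattice d (A : 'M[int]_(2, 2 + d)) :
  (forall b : 'cV[int]_2, exists x : 'cV[int]_(2 + d), A *m x = b) ->
  exists N : 'M[int]_(2, 2 + d), exists H : 'M[int]_(d, 2 + d),
  exists P : 'M[R]_(2 + d, d),
    [/\ N *m A^T = 1%:M, reduced_basis (fun x => x *m A^T = 0) H P &
        `|\det (col_mx N H)| = 1].
Proof.
move=> surj; have [x0 Ax0] := surj (delta_mx 0 0); have [x1 Ax1] := surj (delta_mx 1 0).
pose N : 'M[int]_(2, 2 + d) := \matrix_(i, j) (if i == 0 then x0 else x1) j 0.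
have NA : N *m A^T = 1%:M.
  apply: trmx_inj; rewrite trmx_mul trmxK trmx1; apply/matrixP => i j.
  have colE : (A *m N^T) i j = (A *m (if j == 0 then x0 else x1)) i 0.
    by rewrite !mxE; apply: eq_bigr => l _; rewrite !mxE.
  rewrite colE; have [->|j0] := eqVneq j 0; first by rewrite Ax0 !mxE eqxx andbT.
  have -> : j = 1 by apply/val_inj; case: j j0 {colE} => -[|[|]].
  by rewrite Ax1 !mxE eqxx andbT.
have [||d' [H [P HP]]] := @lattice_basis R _ (fun x => x *m A^T = 0).
- exact: mul0mx.
- by move=> a x y hx hy; rewrite mulmxDl -scalemxAl hx hy scaler0 addr0.
have [HL HPi PM] := HP.
have HA : H *m A^T = 0.
  apply/row_matrixP => i; rewrite row_mul row0; apply/HL.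
  by exists (delta_mx 0 i); rewrite -rowE.
have [Y YE] : exists Y : 'M[int]_(2 + d, d'), 1%:M - A^T *m N = Y *m H.
  have rowY i : exists y, row i (1%:M - A^T *m N) = y *m H.
    apply/HL; rewrite -row_mul mulmxBl -mulmxA NA mulmx1 mul1mx subrr.
    by rewrite raddf0.
  have [y yE] := choice rowY.
  exists (\matrix_i y i); apply/row_matrixP => i.
  by rewrite row_mul rowK.
have HY : H *m Y = 1%:M.
  have : map_mx intr (H *m Y *m H) *m P = map_mx intr H *m P.
    by rewrite -mulmxA -YE mulmxBr mulmx1 mulmxA HA mul0mx subr0.
  rewrite map_mxM -mulmxA HPi mulmx1 => /matrixP e; apply/matrixP => i j.
  by apply/(@intr_inj R); have := e i j; rewrite !mxE => ->; case: eqP.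
have NY : N *m Y = 0.
  have : map_mx intr (N *m Y *m H) *m P = 0.
    by rewrite -mulmxA -YE mulmxBr mulmx1 mulmxA NA mul1mx subrr map_mx0 mul0mx.
  rewrite map_mxM -mulmxA HPi mulmx1 => /matrixP e; apply/matrixP => i j.
  by apply/(@intr_inj R); have := e i j; rewrite !mxE => ->.
have inv1 : col_mx N H *m row_mx A^T Y = 1%:M.
  by rewrite mul_col_row NA NY HA HY -scalar_mx_block.
have inv2 : row_mx A^T Y *m col_mx N H = 1%:M.
  by rewrite mul_row_col -YE addrC subrK.
have dd : d' = d.
  have l1 : (2 + d' <= 2 + d)%N.
    have e : map_mx intr (col_mx N H) *m map_mx intr (row_mx A^T Y) = 1%:M :> 'M[R]_(2 + d').
      by rewrite -map_mxM inv1 map_mx1.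
    by have := mxrankM_maxl (rmx (col_mx N H)) (rmx (row_mx A^T Y));
       rewrite e mxrank1 => h; apply: leq_trans h (rank_leq_col _).
  have l2 : (2 + d <= 2 + d')%N.
    have e : map_mx intr (row_mx A^T Y) *m map_mx intr (col_mx N H) = 1%:M :> 'M[R]_(2 + d).
      by rewrite -map_mxM inv2 map_mx1.
    by have := mxrankM_maxl (rmx (row_mx A^T Y)) (rmx (col_mx N H));
       rewrite e mxrank1 => h; apply: leq_trans h (rank_leq_col _).
  lia.
subst d'; exists N, H, P; split => //.
have := congr1 determinant inv1; rewrite det_mulmx det1 => e.
have : \det (col_mx N H) \is a GRing.unit.
  by apply/unitrPr; eexists; exact: e.
by move=> /orP[] /eqP ->.
Qed.

Lemma solution_le k (g x : 'cV[R]_k) (n : R) : (forall i, 1 <= g i 0) ->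
  (forall i, 0 <= x i 0) -> cdot g x = n -> forall i, 0 <= x i 0 <= n.
Proof.
move=> g1 x0 <- i; rewrite x0 /= /cdot (bigD1 i) //=.
apply: (@le_trans _ _ (g i 0 * x i 0)); first by rewrite ler_peMl.
by rewrite lerDl; apply: sumr_ge0 => j _; rewrite mulr_ge0 // (le_trans ler01).
Qed.

Lemma cdot_mul (K : comNzRingType) k (u x : 'cV[K]_k) : u^T *m x = (cdot u x)%:M.
Proof.
rewrite [LHS]mx11_scalar mxE /cdot; congr (_%:M).
by apply: eq_bigr => i _; rewrite mxE.
Qed.

Lemma mulmx_two_rows (K : comNzRingType) k (A : 'M[K]_(2, k)) (u v x : 'cV[K]_k) :
  A = col_mx u^T v^T ->
  A *m x = col_mx ((cdot u x)%:M : 'M[K]_1) ((cdot v x)%:M : 'M[K]_1).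
Proof. by move=> ->; rewrite -!cdot_mul; exact: (@mul_col_mx _ 1 1 k 1). Qed.

(** Positivity of [g] puts every real solution in the cube of side [n], so two solutions differ by
    at most [n] in each entry. The norm bound on [P] turns this into diameter [d * n] in lattice
    coordinates, whatever the size of the entries of [A]. *)
Lemma count_lattice_solutions d (m g : 'cV[int]_(2 + d)) (A : 'M[int]_(2, 2 + d))
    (j : int) (n : nat) (s : seq 'cV[int]_(2 + d)) :
  A = col_mx m^T g^T -> (forall i, 0 < g i 0) -> (0 < n)%N ->
  (forall b : 'cV[int]_2, exists x : 'cV[int]_(2 + d), A *m x = b) ->
  uniq s ->
  (forall x, x \in s <->
     [/\ forall i, 0 <= x i 0, cdot g x = n%:Z & cdot m x = j]) ->
  `|(size s)%:R - n%:R ^+ d * trunc_power1 A (j%:~R / n%:R)| <=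
    (d * (d * n).+1 ^ d.-1)%:R :> R.
Proof.
move=> AE g0 n0 surj us hs.
have [N [H [P [NA [HL HP PM] detW]]]] := kernel_lattice surj.
have nR : n%:R != 0 :> R by rewrite pnatr_eq0 -lt0n.
pose b : 'cV[int]_2 := col_mx (j%:M : 'M[int]_1) (n%:Z%:M : 'M[int]_1).
have solE x : A *m x = b <-> cdot g x = n%:Z /\ cdot m x = j.
  rewrite (mulmx_two_rows _ AE) /b; split=> [|[-> ->] //].
  move=> /(@eq_col_mx _ 1 1 1)[].
  move=> /(congr1 (fun M : 'M[int]_1 => M 0 0)) + /(congr1 (fun M : 'M[int]_1 => M 0 0)).
  by rewrite !mxE eqxx !mulr1n.
pose p0 : 'rV[int]_(2 + d) := b^T *m N.
have p0A : p0 *m A^T = b^T by rewrite /p0 -mulmxA NA mulmx1.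
have HA : H *m A^T = 0.
  apply/row_matrixP => i; rewrite row_mul row0; apply/HL.
  by exists (delta_mx 0 i); rewrite -rowE.
have detWR : `|\det (col_mx (rmx N) (rmx H))| = 1.
  by rewrite -map_col_mx det_map_mx -intr_norm detW.
(* The point [p0 / n] solves the system with right-hand side [(j / n, 1)]; homogeneity of degree [d]
   absorbs the power of [n], and [|det W| = 1]. *)
have TE : n%:R ^+ d * trunc_power1 A (j%:~R / n%:R) = fine (pvol (rmx p0) (rmx H)).
  rewrite /trunc_power1 (@trunc_power_basis _ _ _ (rmx N) (rmx H) _ _ _ (n%:R^-1 *: rmx p0)).
  - rewrite detWR mul1r pvol_homog ?invr_gt0 ?ltr0n // fine_EFinM; last first.
      by rewrite exprn_ge0 // invr_ge0.
    by rewrite mulrA -exprMn mulfV // expr1n mul1r.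
  - by rewrite map_trmx -map_mxM NA map_mx1.
  - by rewrite map_trmx -map_mxM HA map_mx0.
  - by rewrite -normr_gt0 detWR.
  - rewrite -scalemxAl map_trmx -map_mxM p0A; apply/rowP => i; rewrite !mxE.
    case: splitP => l _; rewrite !mxE !ord1 eqxx !mulr1n; first by rewrite mulrC.
    by rewrite /= -pmulrn mulVf.
have polyhE (y : 'rV[R]_d) : polyh (rmx p0) (rmx H) y ->
    forall i, 0 <= (rmx p0 + y *m rmx H) 0 i <= n%:R.
  move=> hy i; pose x := (rmx p0 + y *m rmx H)^T.
  suff : 0 <= x i 0 <= n%:R by rewrite mxE.
  apply: (@solution_le _ (rmx g) x).
  - by move=> l; rewrite mxE -[1]/(1%:~R) ler_int; have := g0 l; lia.
  - by move=> l; rewrite mxE; exact: hy.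
  have : rmx A *m x = rmx b.
    apply: trmx_inj; rewrite trmx_mul trmxK mulmxDl -mulmxA !map_trmx -!map_mxM.
    by rewrite p0A HA map_mx0 mulmx0 addr0.
  rewrite (@mulmx_two_rows _ _ _ (rmx m) (rmx g)); last first.
    by rewrite AE !map_trmx; exact: (@map_col_mx _ _ _ 1 1).
  rewrite (_ : rmx b = col_mx (rmx (j%:M : 'M[int]_1)) (rmx (n%:Z%:M : 'M[int]_1))); last exact: (@map_col_mx _ _ _ 1 1).
  move=> /(@eq_col_mx _ 1 1 1)[_]; rewrite map_scalar_mx => /(congr1 (fun M : 'M[R]_1 => M 0 0)).
  by rewrite !mxE eqxx !mulr1n.
rewrite TE.
(* A crude bound for solution minus [p0]. It depends on the choice of [p0], but it only fixes the
   size of the enclosing box. *)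
pose M0 : R := n%:R + \sum_i `|rmx p0 0 i|.
have boxed (y : 'rV[R]_d) : polyh (rmx p0) (rmx H) y ->
    forall l, `|y 0 l| <= d%:R * M0.
  move=> hy l; have -> : y = (rmx p0 + y *m rmx H - rmx p0) *m P.
    by rewrite addrAC subrr add0r -mulmxA HP mulmx1.
  apply: PM => i; rewrite mxE [X in _ + X]mxE.
  apply: le_trans (ler_normB _ _) _; apply: lerD.
    by have /andP[h0 h1] := polyhE _ hy i; rewrite ger0_norm.
  by rewrite (bigD1 i) //= lerDl sumr_ge0.
pose M := `|Num.ceil (d%:R * M0)|%N.
have M0_le : d%:R * M0 <= M%:R.
  apply: le_trans (ceil_ge _) _; rewrite [M%:R]pmulrn ler_int; exact: ler_norm.
have -> : (size s)%:R = lat_count M (rmx p0) (rmx H).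
  have -> : lat_count M (rmx p0) (rmx H) =
    (size [seq y <- int_box M d | `[< polyh (rmx p0) (rmx H) (rmx y) >]])%:R.
    rewrite size_filter -sum1_count natr_sum [RHS]big_mkcond /=.
    by apply: eq_bigr => t _; case: ifP.
  set t := [seq y <- _ | _].
  pose phi (y : 'rV[int]_d) := (p0 + y *m H)^T.
  have phi_inj : injective phi.
    move=> y z /trmx_inj/addrI/(congr1 (fun x => rmx x *m P)).
    rewrite !map_mxM -!mulmxA HP !mulmx1 => /matrixP e; apply/matrixP => i l.
    by have := e i l; rewrite !mxE => /intr_inj.
  have polyh_phi y : polyh (rmx p0) (rmx H) (rmx y) <-> forall i, 0 <= phi y i 0.
    have E i : (rmx p0 + rmx y *m rmx H) 0 i = (phi y i 0)%:~R.
      by rewrite -map_mxM -map_mxD mxE [phi _ _ _]mxE.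
    by split => h i; have := h i; rewrite E ler0z.
  suff /perm_size -> : perm_eq s (map phi t) by rewrite size_map.
  apply: uniq_perm => //.
    by rewrite map_inj_uniq // filter_uniq ?int_box_uniq.
  move=> x; apply/idP/mapP => [/hs[x0 gx mx]|[y]].
    have Ax : A *m x = b by apply/solE.
    have [y yE] : exists y, x^T - p0 = y *m H.
      by apply/HL; rewrite mulmxBl p0A -trmx_mul Ax subrr.
    have xE : x = phi y by rewrite /phi -yE addrC subrK trmxK.
    have py : polyh (rmx p0) (rmx H) (rmx y).
      by apply/polyh_phi; rewrite -xE.
    exists y => //; rewrite mem_filter; apply/andP; split; first exact/asboolP.
    rewrite mem_int_box; apply/forallP => l.
    have := le_trans (boxed _ py l) M0_le.
    by rewrite mxE -intr_norm [M%:R]pmulrn ler_int.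
  rewrite mem_filter => /andP[/asboolP/polyh_phi y0 _] ->.
  have [] := (solE (phi y)).1; last by move=> *; apply/hs.
  apply: trmx_inj; rewrite trmx_mul trmxK mulmxDl -[y *m _ *m _]mulmxA HA mulmx0 addr0.
  exact: p0A.
apply: lat_count_pvol.
  move=> y z hy hz l.
  (* In a difference of two solutions [p0] cancels, which leaves the diameter [d * n]. *)
  have -> : y 0 l - z 0 l = ((rmx p0 + y *m rmx H - (rmx p0 + z *m rmx H)) *m P) 0 l.
    rewrite opprD addrACA subrr add0r -mulmxBl -mulmxA HP mulmx1.
    by rewrite [RHS]mxE [X in _ = _ + X]mxE.
  rewrite natrM; apply: PM => i; rewrite mxE [X in _ + X]mxE.
  have /andP[a0 a1] := polyhE _ hy i; have /andP[b0 b1] := polyhE _ hz i.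
  by rewrite ler_norml; lra.
by move=> y hy l; exact: le_trans (boxed _ hy l) M0_le.
Qed.

End lattice_points.

(** * The truncated power as a B-spline *)

Section simplex_slice.
Variable R : realType.
Local Notation mu := (@lebesgue_measure R).

(** The coordinates themselves are constrained to be nonnegative: they will be the weights of the
    middle knots. In the applications [e] is 2, and [c], [B] express the weights of the two extreme
    knots. *)
Definition orthant_vol d e (c : 'rV[R]_e) (B : 'M[R]_(d, e)) : \bar R :=
  pvol (row_mx c 0) (row_mx B (1%:M : 'M[R]_d)).

Definition row2 (a b : R) : 'rV[R]_(1 + 1) := row_mx a%:M b%:M.

Lemma polyh_orthant d e (c : 'rV[R]_e) (B : 'M[R]_(d, e)) :
  polyh (row_mx c 0) (row_mx B (1%:M : 'M[R]_d)) =
  [set z | polyh c B z /\ forall i, 0 <= z 0 i].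
Proof.
rewrite polyh_row_mx; apply/seteqP; split => z [h1 h2]; split => // i.
  by have := h2 i; rewrite mulmx1 add0r.
by rewrite mulmx1 add0r.
Qed.

Lemma polyh_row2 d (a b : R) (u v : 'cV[R]_d) :
  polyh (row2 a b) (row_mx u v) =
  [set z | 0 <= a + (z *m u) 0 0 /\ 0 <= b + (z *m v) 0 0].
Proof.
rewrite /row2 polyh_row_mx; apply/seteqP; split => z /=.
  by move=> [/(_ 0) + /(_ 0)]; rewrite !mxE eqxx !mulr1n => h1 h2; split.
by move=> [h1 h2]; split => i; rewrite ord1 mxE [X in X + _]mxE eqxx mulr1n.
Qed.

Lemma orthant_vol_perm d e (c : 'rV[R]_e) (B : 'M[R]_(d, e)) (s : 'S_d) :
  orthant_vol c (row_perm s B) = orthant_vol c B.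
Proof.
have ps : perm_mx s \in @unitmx R d by exact: unitmx_perm.
rewrite /orthant_vol -(pvol_unit (row_mx c 0) (row_mx B 1%:M) ps).
rewrite det_perm normrX normrN1 expr1n mul1e mul_mx_row mulmx1 -row_permE.
congr (lebesgue_vol _); rewrite !polyh_row_mx; congr (_ `&` _).
have zs (z : 'rV[R]_d) i : (0 + z *m perm_mx s) 0 i = z 0 ((s^-1)%g i).
  by rewrite add0r -{1}(invgK s) -col_permE mxE.
apply/seteqP; split => z h i.
  by rewrite zs; have := h ((s^-1)%g i); rewrite mulmx1 add0r.
by have := h (s i); rewrite zs permK mulmx1 add0r.
Qed.

Lemma integral_power (d : nat) (l : R) : 0 < l ->
  (\int[mu]_t (((t / l) ^+ d) * \1_(`]0%R, l]) t)%:E = (l / d.+1%:R)%:E)%E.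
Proof.
move=> l0; have l_neq0 : l != 0 by rewrite gt_eqF.
pose F (t : measurableTypeR R) := (((t / l) ^+ d) * \1_(`]0%R, l]) t)%:E.
have F0 t : (0 <= F t)%E.
  rewrite lee_fin indicE; case: (boolP (t \in _)) => h; last by rewrite mulr0.
  move: h; rewrite inE /= in_itv /= => /andP[t0 _].
  by rewrite mulr1 exprn_ge0 // divr_ge0 // ltW.
have mF : measurable_fun setT F.
  apply/measurable_EFinP; apply: measurable_funM; last exact: measurable_indic.
  by apply: measurable_funX; apply: measurable_funM.
rewrite -[LHS](@ge0_integral_affine _ F (- l) l) ?oppr_eq0 // normrN gtr0_norm //.
rewrite EFinM; congr (_ * _)%E.
transitivity (\int[mu]_(t in `[0%R, 1%R]) ((1 - t) ^+ d)%:E)%E.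
  rewrite -integral_itv_bndo_bndc; last first.
    apply/measurable_EFinP; apply: measurable_funX; exact: measurable_funB.
  rewrite [RHS]integral_mkcond; apply: eq_integral => t _.
  rewrite /F patchE /= !indicE.
  have -> : (- l * t + l \in `]0%R, l]%classic) = (t \in `[0%R, 1%R[%classic).
    apply/idP/idP; rewrite !inE /= !in_itv /=.
      by nra.
    by nra.
  case: ifP => _; last by rewrite mulr0.
  by rewrite mulr1; congr ((_ ^+ _)%:E); field.
have := @Rintegral_onemXn R d; rewrite /Rintegral /unstable.onem.
(* An infinite integral would have [fine] value 0, which is not [1 / d.+1]. *)
case: (\int[_]_(_ in _) _)%E => [r <-|/esym/eqP|/esym/eqP] //=; by rewrite invr_eq0 pnatr_eq0.
Qed.

(* The slices at t = z . (u0, u) of this cone are homothetic: the slice at t is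
   t / l times the slice at l. *)
Lemma cone_vol d (u0 v0 l m : R) (u v : 'cV[R]_d) :
  0 < u0 -> 0 < l -> (forall i, 0 <= u i 0) ->
  (orthant_vol (row2 l 0)
     (row_mx (- col_mx u0%:M u) (m *: col_mx u0%:M u - l *: col_mx v0%:M v)) =
   (l / (d.+1%:R * u0))%:E *
   orthant_vol (row2 (l / u0) (m - v0 * l / u0))
     (row_mx (- (u0^-1 *: u)) (- (v - (v0 / u0) *: u))))%E.
Proof.
move=> u0_gt0 l_gt0 u_ge0; have u0_neq0 : u0 != 0 by rewrite gt_eqF.
have l_neq0 : l != 0 by rewrite gt_eqF.
pose w : 'cV[R]_d := v - (v0 / u0) *: u.
set c1 : 'rV[R]_(1 + 1) := row2 (l / u0) _.
set B1 : 'M[R]_(d, 1 + 1) := row_mx (- _) (- _).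
(* The slice on which the linear form [z . (u0, u)] equals [t], with the first coordinate eliminated
   as [(t - z . u) / u0]; the Jacobian is [u0^-1], and the same elimination turns [v] into [w]. *)
pose J t : \bar R := pvol
  (row_mx (row2 (l - t) (t * (m - v0 * l / u0))) (row_mx ((t / u0)%:M : 'M[R]_1) 0))
  (row_mx (row_mx (0 : 'cV[R]_d) (- l *: w)) (row_mx (- (u0^-1 *: u)) 1%:M)).
have JE t z : polyh
  (row_mx (row2 (l - t) (t * (m - v0 * l / u0))) (row_mx ((t / u0)%:M : 'M[R]_1) 0))
  (row_mx (row_mx (0 : 'cV[R]_d) (- l *: w)) (row_mx (- (u0^-1 *: u)) 1%:M)) z <->
  [/\ t <= l, l * (z *m w) 0 0 <= t * (m - v0 * l / u0),
      (z *m u) 0 0 <= t & forall i, 0 <= z 0 i].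
  rewrite polyh_row_mx polyh_row2 polyh_row_mx /= mulmx0 -scalemxAr.
  have -> : ((0 : 'M[R]_1) 0 0) = 0 by rewrite mxE.
  have -> : (- l *: (z *m w)) 0 0 = - l * (z *m w) 0 0 by rewrite mxE.
  have E1 : polyh ((t / u0)%:M : 'M[R]_1) (- (u0^-1 *: u)) z <-> (z *m u) 0 0 <= t.
    have e i : ((t / u0)%:M + z *m (- (u0^-1 *: u))) 0 i = (t - (z *m u) 0 0) / u0.
      rewrite ord1 mulmxN -scalemxAr; move: (z *m u) => y.
      by rewrite !mxE eqxx mulr1n; field.
    split=> [/(_ 0)|h i]; rewrite e pmulr_lge0 ?invr_gt0 ?subr_ge0 //.
  have E2 : polyh (0 : 'rV[R]_d) 1%:M z <-> forall i, 0 <= z 0 i.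
    by split => h i; have := h i; rewrite add0r mulmx1.
  rewrite addr0 subr_ge0 mulNr subr_ge0.
  by split=> [[[h1 h2] [/E1 h3 /E2 h4]]|[h1 h2 h3 h4]]; split => //; split => //;
    [exact/E1|exact/E2].
have -> : (orthant_vol (row2 l 0)
     (row_mx (- col_mx u0%:M u) (m *: col_mx u0%:M u - l *: col_mx v0%:M v)) =
     (u0^-1)%:E * \int[mu]_t J t)%E.
  pose r0 : 'rV[R]_(1 + 1 + (1 + d)) :=
    row_mx (row_mx (- u0%:M : 'M[R]_1) ((m * u0 - l * v0)%:M : 'M[R]_1))
           (row_mx (1%:M : 'M[R]_1) (0 : 'rV[R]_d)).
  pose D : 'M[R]_(d, 1 + 1 + (1 + d)) :=
    row_mx (row_mx (- u) (m *: u - l *: v)) (row_mx (0 : 'cV[R]_d) (1%:M : 'M[R]_d)).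
  have -> : orthant_vol (row2 l 0)
     (row_mx (- col_mx u0%:M u) (m *: col_mx u0%:M u - l *: col_mx v0%:M v)) =
     pvol (row_mx (row2 l 0) 0) (col_mx r0 D).
    rewrite /orthant_vol; congr pvol.
    rewrite /r0 /D !scale_col_mx !opp_col_mx add_col_mx.
    rewrite -block_mxEh block_mxEv scalar_mx_block block_mxEv.
    rewrite -block_mxEh block_mxEv !scale_scalar_mx; congr col_mx.
    by congr (row_mx (row_mx _ _) _); rewrite -raddfN -raddfD.
  rewrite -(pvol_lower _ _ _ (- (u0^-1 *: u))).
  rewrite -(@pvol_upper _ _ _ _ r0 _ u0^-1 0) ?invr_eq0 //.
  rewrite gtr0_norm ?invr_gt0 // mul0mx addr0 pvol_col; congr (_ * _)%E.
  apply: eq_integral => t _; rewrite /J /r0 /D /row2 !mul_mx_row !add_row_mx.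
  rewrite !mulNmx -!scalemxAl !mul_mx_scalar mulmx0 !scaler0 oppr0 !addr0 !add0r.
  have z0 : (0 : 'rV[R]_(1 + d)) = row_mx (0 : 'M[R]_1) (0 : 'rV[R]_d).
    by rewrite row_mx0.
  rewrite z0 !scale_row_mx !add_row_mx.
  apply: (f_equal2 (@pvol R d _)); congr (row_mx (row_mx _ _) (row_mx _ _)).
  - by apply/matrixP => i j; rewrite !ord1 !mxE eqxx !mulr1n; field.
  - by apply/matrixP => i j; rewrite !ord1 !mxE eqxx !mulr1n; field.
  - by apply/matrixP => i j; rewrite !ord1 !mxE eqxx !mulr1n; field.
  - by rewrite !scaler0 addr0.
  - by rewrite mulmxN mul_mx_scalar scalerN scalerA mulVf // scale1r opprK addNr.
  - by apply/matrixP => i j; rewrite !mxE; field.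
  - by rewrite scale1r.
have J_out t : ~~ (0 <= t <= l) -> J t = 0%E.
  move=> ht; apply: pvol_empty => z /JE[tl _ zu z0]; move/negP: ht; apply.
  rewrite tl andbT (le_trans _ zu) // mxE; apply: sumr_ge0 => i _.
  by rewrite mulr_ge0.
have J_in t : 0 < t <= l -> J t = (((t / l) ^+ d)%:E * orthant_vol c1 B1)%E.
  move=> /andP[t0 tl]; have tl0 : 0 < t / l by rewrite divr_gt0.
  rewrite /orthant_vol -pvol_homog // /J /pvol; congr lebesgue_vol.
  suff KE z : polyh ((t / l) *: row_mx c1 0) (row_mx B1 1%:M) z <->
      [/\ l * (z *m w) 0 0 <= t * (m - v0 * l / u0),
          (z *m u) 0 0 <= t & forall i, 0 <= z 0 i].
    by apply/seteqP; split => z; [move/JE => -[_ h1 h2 h3]; apply/KE|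
                                  move/KE => -[h1 h2 h3]; apply/JE].
  rewrite scale_row_mx scaler0 polyh_orthant /= /c1 /B1 /row2 scale_row_mx.
  rewrite !scale_scalar_mx -/(row2 _ _) polyh_row2 /= !mulmxN -scalemxAr -/w.
  have -> : (- (u0^-1 *: (z *m u))) 0 0 = - ((z *m u) 0 0 / u0).
    by move: (z *m u) => y; rewrite !mxE mulrC.
  have -> : (- (z *m w)) 0 0 = - (z *m w) 0 0 by rewrite mxE.
  have -> : (0 <= t / l * (l / u0) - (z *m u) 0 0 / u0) = ((z *m u) 0 0 <= t).
    rewrite (_ : _ - _ = (t - (z *m u) 0 0) / u0); last by field; rewrite ?l_neq0 ?u0_neq0.
    by rewrite pmulr_lge0 ?invr_gt0 ?subr_ge0.
  have -> : (0 <= t / l * (m - v0 * l / u0) - (z *m w) 0 0) =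
      (l * (z *m w) 0 0 <= t * (m - v0 * l / u0)).
    by rewrite -(pmulr_rge0 _ l_gt0) -[RHS]subr_ge0; congr (_ <= _); field; rewrite ?l_neq0 ?u0_neq0.
  by split=> [[[h1 h2] h3]|[h1 h2 h3]].
have mJ : measurable_fun [set: measurableTypeR R] J.
  apply: measurable_pvol => i.
  have -> : (fun t => row_mx (row2 (l - t) (t * (m - v0 * l / u0)))
      (row_mx ((t / u0)%:M : 'M[R]_1) (0 : 'rV[R]_d)) 0 i) =
    (fun t => row_mx (row2 l 0) (row_mx (0 : 'M[R]_1) (0 : 'rV[R]_d)) 0 i +
       t * row_mx (row2 (-1) (m - v0 * l / u0))
             (row_mx ((u0^-1)%:M : 'M[R]_1) (0 : 'rV[R]_d)) 0 i).
    apply/funext => t; rewrite !mxE; case: splitP => j _; rewrite !mxE;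
      case: splitP => j' _; rewrite ?ord1 !mxE ?eqxx ?mulr1n; ring.
  by apply: measurable_funD => //; apply: measurable_funM.
transitivity ((u0^-1)%:E * \int[mu]_t
    ((((t / l) ^+ d) * \1_(`]0%R, l]) t)%:E * orthant_vol c1 B1))%E.
  congr (_ * _)%E; apply: ge0_ae_eq_integral => //.
  - apply: emeasurable_funM => //; apply/measurable_EFinP.
    apply: measurable_funM; last exact: measurable_indic.
    by apply: measurable_funX; apply: measurable_funM.
  - by move=> t _; exact: pvol_ge0.
  - move=> t _; apply: mule_ge0; last exact: pvol_ge0.
    rewrite lee_fin indicE; case: (boolP (t \in _)) => h; last by rewrite mulr0.
    move: h; rewrite inE /= in_itv /= => /andP[t0 _].
    by rewrite mulr1 exprn_ge0 // divr_ge0 // ltW.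
  (* The scaling by [t / l] needs [t > 0]; the apex slice [t = 0] is discarded as a null set. *)
  exists [set 0]; split => //; first exact: lebesgue_measure_set1.
  move=> t /=; apply: contra_notP => t0 _; rewrite indicE.
  have [h|h] := boolP (0 < t <= l).
    by rewrite J_in // mem_set /= ?in_itv // mulr1.
  rewrite J_out; last first.
    by apply: contra h => /andP[t_ge ->]; rewrite andbT lt_neqAle t_ge eq_sym; apply/andP; split => //; apply/eqP.
  by rewrite memNset /= ?in_itv /= ?mulr0 ?mul0e //; exact/negP.
rewrite ge0_integralZr //.
- rewrite integral_power // muleA -EFinM; congr (_%:E * _)%E.
  by field; rewrite u0_neq0 addrC natr1 pnatr_eq0.
- apply/measurable_EFinP; apply: measurable_funM; last exact: measurable_indic.
  by apply: measurable_funX; apply: measurable_funM.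
- move=> t _; rewrite lee_fin indicE; case: (boolP (t \in _)) => h; last by rewrite mulr0.
  move: h; rewrite inE /= in_itv /= => /andP[t0 _].
  by rewrite mulr1 exprn_ge0 // divr_ge0 // ltW.
- exact: pvol_ge0.
Qed.

End simplex_slice.

(** * The recurrence for slice volumes *)

Section bspline_volume.
Variable R : realType.

Lemma orthant_vol_swap d (l m : R) (u v : 'cV[R]_d) :
  orthant_vol (row2 l m) (row_mx u v) = orthant_vol (row2 m l) (row_mx v u).
Proof.
rewrite /orthant_vol /pvol !polyh_orthant !polyh_row2; congr lebesgue_vol.
by apply/seteqP; split => z /= [[? ?] ?].
Qed.

(** The cut is the hyperplane [m (z . u) = l (z . v)]. On either side of it one of the bounds
    [z . u <= l] and [z . v <= m] implies the other, so each piece is a cone with apex 0 truncated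
    by a single facet. *)
Lemma orthant_split d (l m : R) (u v : 'cV[R]_d) : 0 < l -> 0 < m ->
  m *: u - l *: v != 0 ->
  (orthant_vol (row2 l m) (row_mx (- u) (- v)) =
   orthant_vol (row2 l 0) (row_mx (- u) (m *: u - l *: v)) +
   orthant_vol (row2 m 0) (row_mx (- v) (l *: v - m *: u)))%E.
Proof.
move=> l0 m0 b0.
rewrite {1}/orthant_vol (pvol_split _ _ (0 : 'M[R]_1) b0).
have E (y : 'cV[R]_d) (z : 'rV[R]_d) : (z *m - y) 0 0 = - (z *m y) 0 0.
  by rewrite mulmxN; move: (z *m y) => t; rewrite mxE.
have F (s t : R) (x y : 'cV[R]_d) (z : 'rV[R]_d) :
    (z *m (s *: x - t *: y)) 0 0 = s * (z *m x) 0 0 - t * (z *m y) 0 0.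
  rewrite mulmxBr -!scalemxAr; move: (z *m x) (z *m y) => p q.
  by rewrite !mxE.
have G (x : 'cV[R]_d) : polyh (0 : 'M[R]_1) x = [set z | 0 <= (z *m x) 0 0].
  apply/seteqP; split => z; first by move=> /(_ 0); rewrite add0r.
  by move=> h i; rewrite add0r !ord1.
rewrite /orthant_vol /pvol oppr0 opprB !(polyh_row_mx (row_mx (row2 l m) 0)).
rewrite !polyh_orthant !polyh_row2 !G; congr (_ + _)%E; congr lebesgue_vol;
  apply/seteqP; split => z /=; rewrite !E !F add0r;
  move: ((z *m u) 0 0) ((z *m v) 0 0) => p q.
- by move=> [[[? ?] ?] ?].
- move=> [[h1 h2] h3]; split => //; split => //; split => //; nra.
- by move=> [[[? ?] ?] ?].
- move=> [[h1 h2] h3]; split => //; split => //; split => //; nra.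
Qed.

(** With [mid_right], the barycentric coordinates of the middle knots with respect to the extreme
    ones. Solving total weight 1 and barycentre [x] for the extreme weights gives
    [(up - x) / D - z . mid_left] and [(x - lo) / D - z . mid_right], where [lo], [up] are the
    extreme knots and [D = up - lo]. *)
Definition mid_left (a : seq R) i d : 'cV[R]_d :=
  \col_j ((a`_(i + d.+1) - a`_(i.+1 + j)) / (a`_(i + d.+1) - a`_i)).

Definition mid_right (a : seq R) i d : 'cV[R]_d :=
  \col_j ((a`_(i.+1 + j) - a`_i) / (a`_(i + d.+1) - a`_i)).

Lemma bspline_rec_eq0 (a : seq R) i j x : a`_i = a`_(i + j.+1) ->
  bspline_rec a i j x = 0.
Proof.
case: j => [|j] /= ->; last by rewrite subrr invr0 !mulr0 !mul0r addr0.
by rewrite addn1; case: ifP => // /andP[h1 /lt_le_trans/(_ h1)]; rewrite ltxx.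
Qed.

Lemma bspline_rec_out (a : seq R) i j x :
  (forall p q, (p <= q)%N -> (q < size a)%N -> a`_p <= a`_q) ->
  (i + j.+1 < size a)%N -> (x < a`_i) || (a`_(i + j.+1) <= x) ->
  bspline_rec a i j x = 0.
Proof.
move=> sa; elim: j i => [|j ih] i /= hi hx.
  by case: ifP => // /andP[h1 h2]; move: hx; rewrite addn1 ltNge h1 leNgt h2.
rewrite (ih i) ?(ih i.+1) ?mulr0 ?addr0 //; try lia.
  case/orP: hx => hx; apply/orP; [left|right; rewrite addSnnS//].
  apply: lt_le_trans hx _; apply: sa; lia.
case/orP: hx => hx; apply/orP; [by left|right].
apply: le_trans hx; apply: sa; lia.
Qed.


(** [cone_vol] eliminates the first coordinate. On the facet without the last knot, the last middle
    knot becomes extreme and its weight must go, so the coordinates are rotated. *)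
Lemma orthant_vol_rotate d (l : R) (u v : 'cV[R]_d) (u0 v0 m : R) (u1 v1 : 'cV[R]_d.+1) :
  (forall j : 'I_d, u1 (lift ord_max j) 0 = u j 0) -> u1 ord_max 0 = u0 ->
  (forall j : 'I_d, v1 (lift ord_max j) 0 = v j 0) -> v1 ord_max 0 = v0 ->
  orthant_vol (row2 l 0) (row_mx (- u1) (m *: u1 - l *: v1)) =
  orthant_vol (row2 l 0)
    (row_mx (- col_mx u0%:M u) (m *: col_mx u0%:M u - l *: col_mx v0%:M v)).
Proof.
move=> hu hu0 hv hv0; pose s := lift_perm (ord0 : 'I_d.+1) ord_max 1%g.
rewrite -(orthant_vol_perm _ _ s); congr orthant_vol.
have rot (w1 : 'cV[R]_d.+1) (w : 'cV[R]_d) w0 :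
    (forall j : 'I_d, w1 (lift ord_max j) 0 = w j 0) -> w1 ord_max 0 = w0 ->
    row_perm s w1 = col_mx w0%:M w.
  move=> h h0; apply/colP => i; rewrite mxE.
  have [j ->|->] := unliftP ord0 i.
    rewrite lift_perm_lift perm1 h.
    rewrite (_ : lift ord0 j = rshift 1 j :> 'I_(1 + d)); last exact: val_inj.
    by rewrite (@col_mxEd _ 1 d).
  rewrite lift_perm_id h0 (_ : ord0 = lshift d 0 :> 'I_(1 + d)); last exact: val_inj.
  by rewrite (@col_mxEu _ 1 d) mxE eqxx mulr1n.
rewrite -(rot u1 u u0 hu hu0) -(rot v1 v v0 hv hv0).
by apply/matrixP => i j; rewrite !mxE; case: splitP => j' _; rewrite !mxE.
Qed.

Lemma col_mx_lift d (w : 'cV[R]_d.+1) (w0 : R) (w' : 'cV[R]_d) :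
  w ord0 0 = w0 -> (forall j, w (lift ord0 j) 0 = w' j 0) ->
  w = col_mx (w0%:M : 'M[R]_1) w'.
Proof.
move=> h h'; apply/colP => j; have [j' ->|->] := unliftP ord0 j.
  rewrite h' (_ : lift ord0 j' = rshift 1 j' :> 'I_(1 + d)); last exact: val_inj.
  by rewrite (@col_mxEd _ 1 d).
rewrite h (_ : ord0 = lshift d 0 :> 'I_(1 + d)); last exact: val_inj.
by rewrite (@col_mxEu _ 1 d) mxE eqxx mulr1n.
Qed.

Lemma orthant_vol_congr d (l m l' m' : R) (u v u' v' : 'cV[R]_d) :
  l = l' -> m = m' -> u = u' -> v = v' ->
  orthant_vol (row2 l m) (row_mx (- u) (- v)) =
  orthant_vol (row2 l' m') (row_mx (- u') (- v')).
Proof. by move=> -> -> -> ->. Qed.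

Lemma mulmx_row_ge0 d (z : 'rV[R]_d) (u : 'cV[R]_d) :
  (forall i, 0 <= z 0 i) -> (forall i, 0 <= u i 0) -> 0 <= (z *m u) 0 0.
Proof. by move=> z0 u0; rewrite mxE; apply: sumr_ge0 => i _; rewrite mulr_ge0. Qed.

Lemma orthant_vol_out d (l m : R) (u v : 'cV[R]_d) :
  (forall i, 0 <= u i 0) -> (forall i, 0 <= v i 0) -> (l < 0) || (m < 0) ->
  orthant_vol (row2 l m) (row_mx (- u) (- v)) = 0%E.
Proof.
move=> u0 v0 lm; apply: pvol_empty => z; rewrite polyh_orthant polyh_row2 /=.
move=> [[]]; rewrite !mulmxN => h1 h2 z0.
have := mulmx_row_ge0 z0 u0; have := mulmx_row_ge0 z0 v0; move: h1 h2.
move: (z *m u) (z *m v) => p q; rewrite !mxE.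
by case/orP: lm => lm; lra.
Qed.

(** Needed for repeated knots: if all middle knots coincide with an extreme one, the facet of one
    cone is degenerate and [cone_vol] would divide by 0. The cone shrinks to the point 0, matching
    the vanishing term of the recurrence. *)
Lemma orthant_vol_degenerate d (l m : R) (v : 'cV[R]_d.+1) :
  0 < l -> (forall i, 0 < v i 0) ->
  orthant_vol (row2 l 0) (row_mx (- 0) (m *: 0 - l *: v)) = 0%E.
Proof.
move=> l0 v0; rewrite /orthant_vol.
set P := polyh (row_mx (row2 l 0) 0) (row_mx (row_mx (- 0) (m *: 0 - l *: v)) 1%:M).
have P0 z : P z -> forall j, z 0 j = 0.
  rewrite /P polyh_orthant polyh_row2 /= scaler0 !add0r => -[[_ h] z0] j.
  have {}h : (z *m v) 0 0 <= 0.
    move: h; rewrite mulmxN -scalemxAr; move: (z *m v) => p; rewrite !mxE.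
    by rewrite oppr_ge0 pmulr_rle0.
  have zv i : 0 <= z 0 i * v i 0 by rewrite mulr_ge0 // ltW.
  apply/eqP; rewrite eq_le z0 andbT -(pmulr_lle0 _ (v0 j)); apply: le_trans h.
  by rewrite mxE (bigD1 j) //= lerDl sumr_ge0.
apply/eqP; rewrite eq_le pvol_ge0 andbT.
have -> : (0 = (0 ^+ d.+1)%:E :> \bar R)%E by rewrite expr0n.
by apply: pvol_diam => // y z hy hz j; rewrite !P0 // subrr normr0.
Qed.

(* Coordinates are the weights of the middle knots. A point of the slice lies in
   the cone over the facet where the weight of the first knot vanishes, or in the
   cone over the facet where that of the last knot does; the two volumes are the
   two terms of the B-spline recurrence. *)
Lemma slice_vol_bspline (a : seq R) i d x :
  (forall p q, (p <= q)%N -> (q < size a)%N -> a`_p <= a`_q) ->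
  (i + d.+1 < size a)%N -> a`_i < a`_(i + d.+1) ->
  (forall p, (p < size a)%N -> x != a`_p) ->
  orthant_vol (row2 ((a`_(i + d.+1) - x) / (a`_(i + d.+1) - a`_i))
                    ((x - a`_i) / (a`_(i + d.+1) - a`_i)))
    (row_mx (- mid_left a i d) (- mid_right a i d)) =
  ((a`_(i + d.+1) - a`_i) * bspline_rec a i d x / d`!%:R)%:E.
Proof.
move=> sa; elim: d i => [|d ih] i hi ai xa.
  rewrite /orthant_vol pvol0 fact0 divr1 /= -!(addn1 i).
  have D0 : 0 < a`_(i + 1) - a`_i by rewrite subr_gt0.
  have xi := xa _ hi; congr _%:E; set b := [forall _, _].
  (* The slice condition is a closed interval and the B-spline uses a half-open one; they agree
     because [x] is not a knot. *)
  have -> : b = (a`_i <= x < a`_(i + 1)).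
    rewrite [x < _]lt_neqAle xi /=; apply/forallP/andP => [h|[h1 h2] j].
      have := h (lshift 0 (lshift 1 0)); have := h (lshift 0 (rshift 1 0)).
      rewrite !row_mxEl row_mxEr [X in 0 <= X]mxE eqxx !mulr1n.
      rewrite [X in _ -> 0 <= X -> _]mxE eqxx mulr1n.
      by rewrite !pmulr_lge0 ?invr_gt0 // !subr_ge0 => -> ->.
    case: (split_ordP j) => j' ->; last by case: j'.
    rewrite row_mxEl; case: (split_ordP j') => l ->; rewrite ?row_mxEl ?row_mxEr;
      by rewrite ord1 mxE eqxx mulr1n pmulr_lge0 ?invr_gt0 // subr_ge0.
  by case: ifP => _; rewrite ?mulr0 // mulfV // gt_eqF.
have e1 : (i.+1 + d.+1 = i + d.+2)%N by rewrite addSnnS.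
have szi : (i < size a)%N by apply: leq_ltn_trans hi; exact: leq_addr.
have szSi : (i.+1 < size a)%N by apply: leq_ltn_trans hi; rewrite -e1 leq_addr.
have i_last : (i + d.+1 <= i + d.+2)%N by rewrite leq_add2l.
have sz_last : (i + d.+1 < size a)%N by exact: leq_ltn_trans hi.
have mid_last (j : 'I_d.+1) : (i.+1 + j <= i + d.+1)%N.
  by rewrite addSnnS leq_add2l ltn_ord.
have i_mid (j : 'I_d.+1) : (i <= i.+1 + j)%N by rewrite addSnnS leq_addr.
have sz_mid (j : 'I_d.+1) : (i.+1 + j < size a)%N by exact: leq_ltn_trans sz_last.
set lo := a`_i; set up := a`_(i + d.+2); set D := up - lo.
have D0 : 0 < D by rewrite subr_gt0.
have Dn : D != 0 by rewrite gt_eqF.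
have lo_le p : (i <= p)%N -> (p <= i + d.+2)%N -> lo <= a`_p <= up.
  by move=> h1 h2; apply/andP; split; apply: sa => //; exact: leq_ltn_trans hi.
have lo_mid (j : 'I_d.+1) : lo <= a`_(i.+1 + j) <= up.
  by apply: lo_le => //; exact: leq_trans i_last.
have u_ge0 j : 0 <= mid_left a i d.+1 j 0.
  rewrite mxE pmulr_lge0 ?invr_gt0 // subr_ge0.
  by have /andP[] := lo_mid j.
have v_ge0 j : 0 <= mid_right a i d.+1 j 0.
  rewrite mxE pmulr_lge0 ?invr_gt0 // subr_ge0.
  by have /andP[] := lo_mid j.
have xlo : x != lo by exact: xa.
have xup : x != up by exact: xa.
have [x_lo|lo_x|/eqP] := ltgtP x lo; last by rewrite (negbTE xlo).
  rewrite orthant_vol_out //; last first.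
    by apply/orP; right; rewrite pmulr_llt0 ?invr_gt0 // subr_lt0.
  by rewrite bspline_rec_out ?mulr0 ?mul0r // x_lo.
have [x_up|up_x|/eqP] := ltgtP x up; last by rewrite (negbTE xup).
  set l := (up - x) / D; set m := (x - lo) / D.
  have l0 : 0 < l by rewrite divr_gt0 // subr_gt0.
  have m0 : 0 < m by rewrite divr_gt0 // subr_gt0.
  set u := mid_left a i d.+1; set v := mid_right a i d.+1.
  have uE j : u j 0 = (up - a`_(i.+1 + j)) / D by rewrite mxE.
  have vE j : v j 0 = (a`_(i.+1 + j) - lo) / D by rewrite mxE.
  (* The first entry equals [x] minus the first middle knot, divided by [D]; it is nonzero since [x]
     is not a knot. *)
  have b0 : m *: u - l *: v != 0.
    apply/eqP => /matrixP/(_ 0 0); rewrite !mxE addn0 -/lo -/up -/D /l /m => h.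
    have /eqP := xa _ szSi; apply; apply/eqP; rewrite -subr_eq0.
    have : (x - a`_i.+1) / D = 0 by rewrite -[RHS]h /D; field.
    by move/eqP; rewrite mulf_eq0 invr_eq0 (negbTE Dn) orbF.
  rewrite orthant_split //.
  have dn0 : (d.+1)%:R != 0 :> R by rewrite pnatr_eq0.
  have fn0 : (d`!)%:R != 0 :> R by rewrite pnatr_eq0 -lt0n fact_gt0.
  have K1 : orthant_vol (row2 l 0) (row_mx (- u) (m *: u - l *: v)) =
      ((up - x) * bspline_rec a i.+1 d x / (d.+1)`!%:R)%:E.
    have /andP[_] := lo_mid ord0; rewrite addn0.
    rewrite le_eqVlt => /predU1P[e|lt_up].
      rewrite (bspline_rec_eq0 (a := a)) ?e1 // mulr0 mul0r.
      have all_up (j : 'I_d.+1) : a`_(i.+1 + j) = up.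
        apply/eqP; rewrite eq_le; have /andP[_ -> /=] := lo_mid j.
        by rewrite -e; apply: sa => //; exact: leq_addr.
      have -> : u = 0 by apply/colP => j; rewrite uE all_up subrr mul0r mxE.
      by apply: orthant_vol_degenerate => // j; rewrite vE all_up divff.
    pose u0 := (up - a`_i.+1) / D; pose v0 := (a`_i.+1 - lo) / D.
    have u0_gt0 : 0 < u0 by rewrite divr_gt0 // subr_gt0.
    have w0 : up - a`_i.+1 != 0 by rewrite gt_eqF // subr_gt0.
    have [u' uu'] : exists u' : 'cV[R]_d, forall j, u (lift ord0 j) 0 = u' j 0.
      by exists (\col_j u (lift ord0 j) 0) => j; rewrite [RHS]mxE.
    have [v' vv'] : exists v' : 'cV[R]_d, forall j, v (lift ord0 j) 0 = v' j 0.
      by exists (\col_j v (lift ord0 j) 0) => j; rewrite [RHS]mxE.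
    have u'E j : u' j 0 = (up - a`_(i.+2 + j)) / D.
      by rewrite -uu' uE lift0 addnS -addSn.
    have v'E j : v' j 0 = (a`_(i.+2 + j) - lo) / D.
      by rewrite -vv' vE lift0 addnS -addSn.
    rewrite (col_mx_lift (w := u) (w0 := u0) (w' := u')); last first.
    - exact: uu'.
    - by rewrite uE addn0.
    rewrite (col_mx_lift (w := v) (w0 := v0) (w' := v')); last first.
    - exact: vv'.
    - by rewrite vE addn0.
    rewrite cone_vol //; last by move=> j; rewrite -uu'.
    (* Eliminating the weight of knot [i.+1] leaves barycentric coordinates with respect to the
       extreme knots [i.+1] and [i + d.+2] of the facet, as the induction hypothesis requires. *)
    have <- : ((up - a`_i.+1) * bspline_rec a i.+1 d x / (d`!)%:R)%:E =
      orthant_vol (row2 (l / u0) (m - v0 * l / u0))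
        (row_mx (- (u0^-1 *: u')) (- (v' - (v0 / u0) *: u'))).
      have := ih i.+1; rewrite e1 => /(_ hi lt_up xa) <-.
      apply: orthant_vol_congr.
      - by rewrite -/up /l /u0; field; rewrite Dn w0.
      - by rewrite -/up -/lo /m /v0 /l /u0 /D; field; rewrite -/D Dn w0.
      - apply/colP => j; rewrite !mxE u'E e1 /u0 -/up; field; by rewrite Dn w0.
      - apply/colP => j; rewrite !mxE v'E u'E e1 /v0 /u0 -/up /D; field.
        by rewrite -/D Dn w0.
    rewrite -EFinM; congr _%:E; rewrite /l /u0 factS natrM.
    by field; rewrite Dn fn0 addrC natr1 dn0 w0.
  have K2 : orthant_vol (row2 m 0) (row_mx (- v) (l *: v - m *: u)) =
      ((x - lo) * bspline_rec a i d x / (d.+1)`!%:R)%:E.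
    have /andP[+ _] := lo_le (i + d.+1)%N (leq_addr _ _) i_last.
    rewrite le_eqVlt => /predU1P[e|lt_lo].
      rewrite (bspline_rec_eq0 (a := a)) // mulr0 mul0r.
      have all_lo (j : 'I_d.+1) : a`_(i.+1 + j) = lo.
        apply/eqP; rewrite eq_le; have /andP[-> _ /=] := lo_mid j.
        by rewrite e andbT; exact: sa.
      have -> : v = 0 by apply/colP => j; rewrite vE all_lo subrr mul0r mxE.
      by apply: orthant_vol_degenerate => // j; rewrite uE all_lo divff.
    pose u0 := (up - a`_(i + d.+1)) / D; pose v0 := (a`_(i + d.+1) - lo) / D.
    have v0_gt0 : 0 < v0 by rewrite divr_gt0 // subr_gt0.
    have w0 : a`_(i + d.+1) - lo != 0 by rewrite gt_eqF // subr_gt0.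
    have [u' uu'] : exists u' : 'cV[R]_d, forall j, u (lift ord_max j) 0 = u' j 0.
      by exists (\col_j u (lift ord_max j) 0) => j; rewrite [RHS]mxE.
    have [v' vv'] : exists v' : 'cV[R]_d, forall j, v (lift ord_max j) 0 = v' j 0.
      by exists (\col_j v (lift ord_max j) 0) => j; rewrite [RHS]mxE.
    have u'E j : u' j 0 = (up - a`_(i.+1 + j)) / D.
      by rewrite -uu' uE lift_max.
    have v'E j : v' j 0 = (a`_(i.+1 + j) - lo) / D.
      by rewrite -vv' vE lift_max.
    rewrite (@orthant_vol_rotate d m v' u' v0 u0 l v u); first last.
    - by rewrite uE /= addSnnS.
    - exact: uu'.
    - by rewrite vE /= addSnnS.
    - exact: vv'.
    rewrite cone_vol //; last by move=> j; rewrite -vv'.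
    have <- : ((a`_(i + d.+1) - lo) * bspline_rec a i d x / (d`!)%:R)%:E =
      orthant_vol (row2 (m / v0) (l - u0 * m / v0))
        (row_mx (- (v0^-1 *: v')) (- (u' - (u0 / v0) *: v'))).
      rewrite orthant_vol_swap -ih //.
      apply: orthant_vol_congr.
      - by rewrite -/up -/lo /m /v0 /l /u0 /D; field; rewrite -/D Dn w0.
      - by rewrite -/lo /m /v0; field; rewrite Dn w0.
      - apply/colP => j; rewrite !mxE v'E u'E /v0 /u0 -/lo /D; field.
        by rewrite -/D Dn w0.
      - apply/colP => j; rewrite !mxE v'E /v0 -/lo; field; by rewrite Dn w0.
    rewrite -EFinM; congr _%:E; rewrite /m /v0 factS natrM.
    by field; rewrite Dn fn0 addrC natr1 dn0 w0.
  rewrite K1 K2 -EFinD; congr _%:E.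
  rewrite [bspline_rec a i d.+1 x]/= -/lo -/up -/D factS natrM.
  by field; rewrite Dn fn0 addrC natr1 dn0.
rewrite orthant_vol_out //; last first.
  by apply/orP; left; rewrite pmulr_llt0 ?invr_gt0 // subr_lt0.
by rewrite bspline_rec_out ?mulr0 ?mul0r // (ltW up_x) orbT.
Qed.

End bspline_volume.

(** * From fibres of the matrix to slices of the simplex *)

Section trunc_power_bspline.
Variable R : realType.
Variable d : nat.
Variables (m g : 'cV[int]_(2 + d)) (A : 'M[int]_(2, 2 + d)).
Hypothesis AE : A = col_mx m^T g^T.
Hypothesis g_gt0 : forall i, 0 < g i 0.
Hypothesis surj : forall b : 'cV[int]_2, exists x : 'cV[int]_(2 + d), A *m x = b.

Local Notation rmx := (map_mx (intr : int -> R)).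

Definition knot (i : 'I_(2 + d)) : R := (m i 0)%:~R / (g i 0)%:~R.

Let gR0 i : (g i 0)%:~R != 0 :> R.
Proof. by rewrite intr_eq0 gt_eqF. Qed.

Let gR_gt0 i : 0 < (g i 0)%:~R :> R.
Proof. by rewrite ltr0z. Qed.

(** If all ratios were equal, [m] would be a multiple of [g], and the image of [A] could not contain
    [(1, 0)]. *)
Lemma knot_neq : exists i j, knot i != knot j.
Proof.
apply: contrapT => h; have all_eq i j : knot i = knot j.
  by apply: contrapT => hij; apply: h; exists i, j; exact/eqP.
have [x xE] := surj (col_mx (1%:M : 'M[int]_1) (0 : 'M[int]_1)).
rewrite (mulmx_two_rows x AE) in xE.
have [/(congr1 (fun M : 'M[int]_1 => M 0 0)) + /(congr1 (fun M : 'M[int]_1 => M 0 0))] :=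
  @eq_col_mx _ 1 1 1 _ _ _ _ xE.
rewrite !mxE eqxx !mulr1n => mx gx.
have : (cdot m x)%:~R = knot ord0 * (cdot g x)%:~R :> R.
  rewrite /cdot !rmorph_sum mulr_sumr; apply: eq_bigr => i _.
  by rewrite !rmorphM /= (all_eq ord0 i) /knot mulrA divfK.
by rewrite mx gx mulr0 => /eqP; rewrite oner_eq0.
Qed.

Let s := sort <=%O (ratio_knots R m g).

Lemma size_sorted_knots : size s = (2 + d)%N.
Proof. by rewrite size_sort size_map size_enum_ord. Qed.

Lemma sorted_knots_le p q : (p <= q)%N -> (q < size s)%N -> s`_p <= s`_q.
Proof.
move=> pq qs; apply: (@sorted_leq_nth _ <=%O) => //.
- exact: le_trans.
- exact: sort_le_sorted.
- exact: leq_ltn_trans qs.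
Qed.

Lemma sorted_knots_perm : exists t : 'S_(2 + d), forall i : 'I_(2 + d), s`_i = knot (t i).
Proof.
have szr : size (ratio_knots R m g) == (2 + d)%N by rewrite size_map size_enum_ord.
pose T := Tuple szr.
have [|t tE] := @tuple_permP _ _ s T _.
  by rewrite perm_sort.
exists t => i; rewrite tE -tnth_nth tnth_map tnth_ord_tuple (tnth_nth 0) /=.
by rewrite (nth_map i) ?size_enum_ord // nth_ord_enum.
Qed.

Lemma sorted_knots_lt : s`_0 < s`_d.+1.
Proof.
have sz := size_sorted_knots.
rewrite lt_neqAle sorted_knots_le ?sz // andbT; apply/eqP => e.
have [i [j]] := knot_neq; apply/negP; rewrite negbK.
suff all0 l : knot l = s`_0 by rewrite !all0.
have : knot l \in s by rewrite mem_sort; apply/mapP; exists l; rewrite ?mem_enum.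
move=> /(nthP 0)[p ps <-]; apply/eqP; rewrite eq_le.
rewrite (@sorted_knots_le 0%N p) // andbT e.
by apply: sorted_knots_le; rewrite ?sz //; move: ps; rewrite sz.
Qed.

(* With the smallest and the largest knot in front, the columns split into a 2 x 2
   invertible block and the middle knots. *)
Definition extremes_first (p : 'I_(2 + d)) : 'I_(2 + d) :=
  if p == 0 :> nat then ord0 else if p == 1 :> nat then ord_max else inord p.-1.

Lemma val_extremes_first p : val (extremes_first p) =
  if p == 0 :> nat then 0%N else if p == 1 :> nat then d.+1 else p.-1.
Proof.
rewrite /extremes_first; case: ifP => // _; case: ifP => // _.
by rewrite /= inordK // (leq_ltn_trans (leq_pred _)).
Qed.

Lemma extremes_first_inj : injective extremes_first.
Proof.
move=> p q /(congr1 val); rewrite !val_extremes_first => e; apply: val_inj => /=.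
have hp : (p < 2 + d)%N := ltn_ord p; have hq : (q < 2 + d)%N := ltn_ord q.
move: e hp hq; move: (nat_of_ord p) (nat_of_ord q) => i j.
by case: (eqVneq i 0%N); case: (eqVneq j 0%N); case: (eqVneq i 1%N);
  case: (eqVneq j 1%N); lia.
Qed.

(** Rescaling coordinate [i] by [g i] makes the columns of [A] equal to [(knot i, 1)], so the fibre
    becomes a slice of the standard simplex. This rescaling accounts for the product of the
    generators, and the factor [d.+1] in the definition of [bspline] turns [d]![into](d.+1)[!]. *)
Lemma trunc_power1_bspline (x : R) : (forall p, (p < size s)%N -> x != s`_p) ->
  trunc_power1 A x =
  bspline (ratio_knots R m g) x / ((d.+1)`!%:R * \prod_(i < 2 + d) (g i 0)%:~R).
Proof.
move=> xk; have sz := size_sorted_knots; have [t tE] := sorted_knots_perm.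
pose r := perm (inj_comp (@perm_inj _ t) extremes_first_inj).
have rE p : knot (r p) = s`_(extremes_first p) by rewrite permE /= -tE.
pose E : 'M[R]_(2 + d) := perm_mx r *m diag_mx (\row_i ((g i 0)%:~R)^-1).
have EE (e : nat) (w : 'M[R]_(e, 2 + d)) i p : (w *m E) i (r p) = w i p / (g (r p) 0)%:~R.
  rewrite mulmxA mul_mx_diag mxE [X in _ * X]mxE; congr (_ / _).
  by rewrite -{1}(invgK r) -col_permE mxE permK.
have polyhE (c : 'rV[R]_(2 + d)) (B : 'M[R]_(d, 2 + d)) : polyh (c *m E) (B *m E) = polyh c B.
  apply/seteqP; split => z h i.
    have := h (r i); rewrite mulmxA -mulmxDl EE.
    by rewrite pmulr_lge0 ?invr_gt0.
  by rewrite mulmxA -mulmxDl -(permKV r i) EE pmulr_lge0 ?invr_gt0.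
pose C : 'M[R]_(2 + d, 2) := E *m (rmx A)^T.
have CE0 p k : C p k = if k == 0 then s`_(val (extremes_first p)) else 1.
  rewrite /C /E -mulmxA mul_diag_mx -row_permE !mxE.
  have AkE (i : 'I_(2 + d)) : A k i = if k == 0 then m i 0 else g i 0.
    rewrite AE; have [->|k0] := eqVneq k 0.
      rewrite (_ : 0 = lshift 1 0 :> 'I_(1 + 1)); last exact: val_inj.
      by rewrite (@col_mxEu _ 1 1) mxE.
    have -> : k = rshift 1 0 :> 'I_(1 + 1).
      by apply: val_inj; case: k k0 => -[|[|]].
    by rewrite (@col_mxEd _ 1 1) mxE.
  rewrite AkE; case: ifP => _; last by rewrite mulVf.
  by rewrite mulrC -/(knot _) rE.
pose S := usubmx C; pose X := dsubmx C.
have CE : C = col_mx S X by rewrite vsubmxK.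
set lo := s`_0; set up := s`_d.+1.
have lo_up : lo < up := sorted_knots_lt.
have S_lo k : usubmx (S : 'M[R]_(1 + 1, 2)) 0 k = if k == 0 then lo else 1.
  by rewrite mxE [LHS]mxE CE0 val_extremes_first.
have S_up k : dsubmx (S : 'M[R]_(1 + 1, 2)) 0 k = if k == 0 then up else 1.
  by rewrite mxE [LHS]mxE CE0 val_extremes_first.
have X_mid j k : X j k = if k == 0 then s`_(1 + j) else 1.
  by rewrite mxE CE0 val_extremes_first.
have SE : S = col_mx (usubmx (S : 'M[R]_(1 + 1, 2))) (dsubmx (S : 'M[R]_(1 + 1, 2))).
  by rewrite (@vsubmxK _ 1 1).
have detS : \det S = lo - up.
  have det2 (M : 'M[R]_2) : \det M = M 0 0 * M 1 1 - M 0 1 * M 1 0.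
    have c0 : cofactor M 0 ord0 = M 1 1.
      rewrite /cofactor det_mx11 !mxE /= expr0 mul1r.
      by congr (M _ _); exact: val_inj.
    have c1 : cofactor M 0 (lift ord0 ord0) = - M 1 0.
      rewrite /cofactor det_mx11 !mxE /= expr1 mulN1r.
      by congr (- M _ _); exact: val_inj.
    rewrite (expand_det_row M 0) !big_ord_recl big_ord0 c0 c1 addr0 mulrN.
    by congr (_ - M _ _ * _); exact: val_inj.
  have S0 k : S 0 k = if k == 0 then lo else 1.
    by rewrite mxE CE0 val_extremes_first.
  have S1 k : S 1 k = if k == 0 then up else 1.
    by rewrite mxE CE0 val_extremes_first.
  by rewrite det2 !S0 !S1 /= mulr1 mul1r.
have unitS : S \in unitmx by rewrite unitmxE unitfE detS subr_eq0 lt_eqF.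
have D0 : up - lo != 0 by rewrite subr_eq0 gt_eqF.
(* [N0] solves the two equations with the extreme knots alone. The rows of [B0] put weight on one
   middle knot and take it from the extreme ones, keeping total weight and barycentre; [c0] is the
   point of the slice carried by the extreme knots. *)
pose N0 : 'M[R]_(2, 2 + d) := row_mx (invmx S) 0.
pose u := mid_left s 0 d; pose v := mid_right s 0 d.
pose B0 : 'M[R]_(d, 2 + d) := row_mx (row_mx (- u) (- v)) 1%:M.
pose c0 : 'rV[R]_(2 + d) := row_mx (row2 ((up - x) / (up - lo)) ((x - lo) / (up - lo))) 0.
have NA : (N0 *m E) *m (rmx A)^T = 1%:M.
  by rewrite -mulmxA -/C CE mul_row_col mul0mx addr0 mulVmx.
have BA : (B0 *m E) *m (rmx A)^T = 0.
  rewrite -mulmxA -/C CE mul_row_col mul1mx SE (@mul_row_col _ d 1 1 2).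
  apply/matrixP => j k; rewrite mxE [X in X + _]mxE !mulNmx X_mid.
  rewrite [X in X + _ + _]mxE [X in - X + _ + _]mxE big_ord1 S_lo.
  rewrite [X in _ + X + _]mxE [X in _ - X + _]mxE big_ord1 S_up.
  by rewrite !mxE add0n -/lo -/up; case: ifP => _; field.
have cA : (c0 *m E) *m (rmx A)^T = (col_mx (x%:M : 'cV[R]_1) (1%:M : 'cV[R]_1) : 'cV[R]_2)^T.
  rewrite -mulmxA -/C CE mul_row_col mul0mx addr0 SE (@mul_row_col _ 1 1 1 2) !mul_scalar_mx.
  apply/rowP => q; rewrite mxE [X in X + _]mxE [X in _ + X]mxE S_lo S_up.
  rewrite [RHS]mxE; have [->|q0] := eqVneq q 0.
    rewrite (_ : 0 = lshift 1 0 :> 'I_(1 + 1)); last exact: val_inj.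
    by rewrite (@col_mxEu _ 1 1) mxE eqxx mulr1n /=; field.
  have -> : q = rshift 1 0 :> 'I_(1 + 1).
    by apply: val_inj; case: q q0 => -[|[|]].
  by rewrite (@col_mxEd _ 1 1) mxE eqxx mulr1n /=; field.
have detE : `|\det E| = (\prod_(i < 2 + d) (g i 0)%:~R)^-1.
  rewrite det_mulmx det_perm det_diag normrM normrX normrN1 expr1n mul1r.
  rewrite ger0_norm; first by rewrite -prodfV; apply: eq_bigr => i _; rewrite mxE.
  by apply: prodr_ge0 => i _; rewrite mxE invr_ge0 ltW.
have detW : \det (col_mx (N0 *m E) (B0 *m E)) = (lo - up)^-1 * \det E.
  rewrite -mul_col_mx det_mulmx; congr (_ * _).
  have -> : col_mx N0 B0 = block_mx (invmx S) 0 (row_mx (- u) (- v)) 1%:M by [].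
  by rewrite det_lblock det1 mulr1 det_inv detS.
have detE0 : \det E != 0.
  rewrite -normr_gt0 detE invr_gt0; apply: prodr_gt0 => i _; exact: gR_gt0.
rewrite /trunc_power1 (trunc_power_basis NA BA _ cA); last first.
  by rewrite detW mulf_neq0 // invr_eq0 subr_eq0 lt_eqF.
rewrite detW normrM detE normfV ltr0_norm ?subr_lt0 // opprB.
rewrite /pvol polyhE -/(pvol c0 B0).
have := @slice_vol_bspline R s 0 d x sorted_knots_le _ sorted_knots_lt xk.
rewrite add0n sz ltnSn -/u -/v -/lo -/up => /(_ isT).
rewrite /orthant_vol -/c0 -/B0 => -> /=.
rewrite /bspline -/s sz /= factS natrM.
have dn0 : (d.+1)%:R != 0 :> R by rewrite pnatr_eq0.
have fn0 : (d`!)%:R != 0 :> R by rewrite pnatr_eq0 -lt0n fact_gt0.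
have G0 : \prod_(i < 2 + d) (g i 0)%:~R != 0 :> R.
  by rewrite gt_eqF //; apply: prodr_gt0 => i _; exact: gR_gt0.
by field; rewrite G0 fn0 addrC natr1 dn0 D0.
Qed.

End trunc_power_bspline.

(** * Riemann sums and assembly *)

Section riemann_sum.
Variable R : realType.
Local Notation mu := (@lebesgue_measure R).

Lemma lipschitz_within_continuous (A : set R) (h : R -> R) (C : R) : 0 <= C ->
  (forall x y, A x -> A y -> `|h x - h y| <= C * `|x - y|) ->
  {within A, continuous h}.
Proof.
move=> C0 hC; apply/subspace_continuousP => x Ax.
apply/cvgrPdist_lt => e e0.
have d0 : 0 < e / (C + 1) by rewrite divr_gt0 // ltr_wpDl.
have : \forall y \near x, `|x - y| < e / (C + 1) by apply/nbhs_ballP; exists (e / (C + 1)).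
rewrite near_withinE; apply: filterS => y xy Ay /=.
apply: le_lt_trans (hC _ _ Ax Ay) _.
apply: (@le_lt_trans _ _ ((C + 1) * `|x - y|)); first by rewrite ler_wpM2r // lerDl.
by rewrite mulrC -ltr_pdivlMr // ltr_wpDl.
Qed.

Lemma Rintegral_lipschitz (h : R -> R) (C a b c : R) : 0 <= C -> a <= b ->
  a <= c <= b ->
  (forall x y, a <= x <= b -> a <= y <= b -> `|h x - h y| <= C * `|x - y|) ->
  `|\int[mu]_(x in `]a, b]) h x - (b - a) * h c| <= C * (b - a) * (b - a).
Proof.
move=> C0 ab cab hC.
have hint : mu.-integrable `[a, b] (EFin \o h).
  apply: continuous_compact_integrable; first exact: segment_compact.
  apply: (@lipschitz_within_continuous _ _ C) => //.
have sub : `]a, b] `<=` `[a, b].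
  by move=> x /=; rewrite !in_itv /= => /andP[/ltW -> ->].
have hint' : mu.-integrable `]a, b] (EFin \o h) by exact: integrableS hint.
have cint (r : R) : mu.-integrable `]a, b] (EFin \o cst r).
  apply: (@integrableS _ _ _ mu `[a, b]) => //.
  apply: continuous_compact_integrable; first exact: segment_compact.
  by apply: continuous_subspaceT; exact: cst_continuous.
have len : fine (mu `]a, b]) = b - a.
  rewrite lebesgue_measure_itv /= lte_fin; case: ltgtP ab => // e _.
  by rewrite e subrr.
have E (r : R) : \int[mu]_(x in `]a, b]) r = r * (b - a) by rewrite Rintegral_cst // len.
rewrite [(b - a) * h c]mulrC -(E (h c)) -RintegralB //; last exact: (cint (h c)).
have mB : mu.-integrable `]a, b] (EFin \o (fun x => h x - h c)).
  have -> : EFin \o (fun x => h x - h c) = ((EFin \o h) \- (EFin \o cst (h c)))%E by [].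
  exact: integrableB.
apply: le_trans (le_normr_Rintegral _ mB) _ => //.
rewrite -(E (C * (b - a))); apply: le_Rintegral => //.
- by have := integrable_norm mB.
- exact: cint.
move=> x /=; rewrite in_itv /= => /andP[ax xb].
have xab : a <= x <= b by rewrite ltW.
apply: le_trans (hC _ _ xab cab) _; rewrite ler_wpM2l //.
by case/andP: xab => *; case/andP: cab => *; rewrite ler_norml; lra.
Qed.


Lemma Rintegral_bounded (h : R -> R) (C a b : R) : a <= b ->
  mu.-integrable `]a, b] (EFin \o h) ->
  (forall x, a < x <= b -> `|h x| <= C) ->
  `|\int[mu]_(x in `]a, b]) h x| <= C * (b - a).
Proof.
move=> ab hint hC.
have len : fine (mu `]a, b]) = b - a.
  rewrite lebesgue_measure_itv /= lte_fin; case: ltgtP ab => // e _.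
  by rewrite e subrr.
have cint : mu.-integrable `]a, b] (EFin \o cst C).
  apply: (@integrableS _ _ _ mu `[a, b]) => //.
    by move=> x /=; rewrite !in_itv /= => /andP[/ltW -> ->].
  apply: continuous_compact_integrable; first exact: segment_compact.
  by apply: continuous_subspaceT; exact: cst_continuous.
apply: le_trans (le_normr_Rintegral _ hint) _ => //.
rewrite -len -[C * _]Rintegral_cst //; apply: le_Rintegral => //.
  by have := integrable_norm hint.
Qed.

(* The first node takes the cell [a, p] in place of a full cell of length 1/n,
   so the two end errors are C2 (1/n - (p - a)) and C2 (b - q). *)
Lemma riemann_sum_lipschitz (h : R -> R) (C2 C3 a b : R) (n : nat) (j0 : int) (N : nat) :
  0 <= C3 -> (0 < n)%N ->
  (forall x, a <= x <= b -> `|h x| <= C2) ->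
  (forall x y, a <= x <= b -> a <= y <= b -> `|h x - h y| <= C3 * `|x - y|) ->
  a <= j0%:~R / n%:R -> j0%:~R / n%:R - a <= n%:R^-1 ->
  (j0 + N%:Z)%:~R / n%:R <= b -> b - (j0 + N%:Z)%:~R / n%:R <= n%:R^-1 ->
  `|\sum_(0 <= i < N.+1) h ((j0 + i%:Z)%:~R / n%:R) - n%:R * \int[mu]_(x in `[a, b]) h x| <=
  C3 * (b - a) + 2 * C2.
Proof.
move=> C30 n0 hC2 hC3 ap pa qb bq.
have nR : 0 < n%:R :> R by rewrite ltr0n.
have nN : n%:R != 0 :> R by rewrite gt_eqF.
pose p i : R := (j0 + i%:Z)%:~R / n%:R.
have pE i : p i = j0%:~R / n%:R + i%:R / n%:R by rewrite /p intrD -pmulrn mulrDl.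
have pS i : p i.+1 = p i + n%:R^-1 by rewrite !pE -natr1 mulrDl mul1r addrA.
have p_le i : (i <= N)%N -> a <= p i <= b.
  move=> iN; apply/andP; split.
    by rewrite pE; apply: le_trans ap _; rewrite lerDl divr_ge0.
  by apply: le_trans qb; rewrite -/(p N) !pE lerD2l ler_pM2r ?invr_gt0 // ler_nat.
have ab : a <= b by have /andP[] := p_le 0%N (leq0n _); exact: le_trans.
have hint : mu.-integrable `[a, b] (EFin \o h).
  apply: continuous_compact_integrable; first exact: segment_compact.
  exact: (@lipschitz_within_continuous _ _ C3).
pose F x := \int[mu]_(t in `[a, x]) h t.
have Fa : F a = 0.
  by rewrite /F set_itv1 /Rintegral integral_set1.
have FB x y : a <= x -> x <= y -> y <= b -> F y - F x = \int[mu]_(t in `]x, y]) h t.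
  move=> ax xy yb; rewrite /F Rintegral_itvB //.
  apply: integrableS hint => // t /=; rewrite !in_itv /= => /andP[-> ty].
  exact: le_trans yb.
have F1 x y c : a <= x -> x <= y -> y <= b -> x <= c <= y ->
    `|F y - F x - (y - x) * h c| <= C3 * (y - x) * (y - x).
  move=> ax xy yb xcy; rewrite FB //; apply: Rintegral_lipschitz => //.
  move=> s t /andP[s1 s2] /andP[t1 t2]; apply: hC3.
    by rewrite (le_trans ax) // (le_trans s2).
  by rewrite (le_trans ax) // (le_trans t2).
have F2 x y : a <= x -> x <= y -> y <= b -> `|F y - F x| <= C2 * (y - x).
  move=> ax xy yb; rewrite FB //; apply: Rintegral_bounded => //.
    apply: integrableS hint => // t /=; rewrite !in_itv /= => /andP[t1 t2].
    by rewrite (le_trans ax (ltW t1)) (le_trans t2 yb).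
  by move=> t /andP[t1 t2]; apply: hC2; rewrite (le_trans ax (ltW t1)) (le_trans t2 yb).
(* With the right endpoint as node, a full cell costs [n * C3 / n ^ 2 = C3 / n], that is, [C3] times
   its length. *)
have cells i : (i <= N)%N ->
    `|\sum_(1 <= l < i.+1) h (p l) - n%:R * (F (p i) - F (p 0%N))| <= C3 * (i%:R / n%:R).
  elim: i => [|i ih] iN.
    by rewrite big_geq // subrr mulr0 subr0 normr0 mul0r mulr0.
  have /andP[ai ib] := p_le _ (ltnW iN); have /andP[_ iSb] := p_le _ iN.
  have ilei : p i <= p i.+1 by rewrite pS lerDl invr_ge0 ltW.
  rewrite big_nat_recr //=.
  have -> : \sum_(1 <= l < i.+1) h (p l) + h (p i.+1) - n%:R * (F (p i.+1) - F (p 0%N)) =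
     (\sum_(1 <= l < i.+1) h (p l) - n%:R * (F (p i) - F (p 0%N))) -
     n%:R * (F (p i.+1) - F (p i) - (p i.+1 - p i) * h (p i.+1)).
    by rewrite {4}pS; field.
  apply: le_trans (ler_normB _ _) _.
  have -> : i.+1%:R / n%:R = i%:R / n%:R + n%:R^-1 :> R by rewrite -natr1 mulrDl mul1r.
  rewrite [C3 * _]mulrDr; apply: lerD; first exact: ih (ltnW iN).
  rewrite normrM gtr0_norm //.
  have := F1 (p i) (p i.+1) (p i.+1) ai ilei iSb; rewrite ilei lexx => /(_ isT).
  have -> : p i.+1 - p i = n%:R^-1 by rewrite pS addrAC subrr add0r.
  move=> h1; rewrite -(ler_pM2l nR) in h1; apply: le_trans h1 _.
  by rewrite le_eqVlt; apply/orP; left; apply/eqP; field.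
have cellsN := cells N (leqnn _).
rewrite big_ltn // -/(F b); rewrite -/(p 0%N).
have p0E : p 0%N = j0%:~R / n%:R by rewrite pE mul0r addr0.
have /andP[ap0 p0b] := p_le 0%N (leq0n _).
have first_cell : `|h (p 0%N) - n%:R * F (p 0%N)| <=
    C2 * (1 - n%:R * (p 0%N - a)) + C3 * (p 0%N - a).
  have := F1 a (p 0%N) (p 0%N) (lexx _) ap0 p0b; rewrite ap0 lexx Fa subr0 => /(_ isT) h1.
  have h2 := hC2 _ (p_le 0%N (leq0n _)).
  have pn : n%:R * (p 0%N - a) <= 1.
    by rewrite mulrC -ler_pdivlMr // div1r p0E.
  have -> : h (p 0%N) - n%:R * F (p 0%N) = (1 - n%:R * (p 0%N - a)) * h (p 0%N) -
     n%:R * (F (p 0%N) - (p 0%N - a) * h (p 0%N)) by ring.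
  apply: le_trans (ler_normB _ _) _; apply: lerD.
    by rewrite normrM ger0_norm ?subr_ge0 // mulrC ler_wpM2r // subr_ge0.
  rewrite normrM gtr0_norm //; rewrite -(ler_pM2l nR) in h1; apply: le_trans h1 _.
  rewrite [n%:R * _](_ : _ = (n%:R * (p 0%N - a)) * (C3 * (p 0%N - a))); last by ring.
  by rewrite ler_piMl // mulr_ge0 // subr_ge0.
have /andP[aN Nb] := p_le N (leqnn _).
have last_cell : n%:R * `|F b - F (p N)| <= C2 * (n%:R * (b - p N)).
  by rewrite mulrCA ler_pM2l //; exact: F2.
have pN : n%:R * (b - p N) <= 1 by rewrite mulrC -ler_pdivlMr // div1r.
have C2_ge0 : 0 <= C2 by apply: le_trans (hC2 _ (p_le 0%N (leq0n _))).
set S1 := \sum_(1 <= l < N.+1) _ in cellsN *.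
have -> : h (p 0%N) + S1 - n%:R * F b = (h (p 0%N) - n%:R * F (p 0%N)) +
   (S1 - n%:R * (F (p N) - F (p 0%N))) - n%:R * (F b - F (p N)) by ring.
apply: le_trans (ler_normB _ _) _; rewrite [`|n%:R * _|]normrM (gtr0_norm nR).
apply: le_trans (lerD (le_trans (ler_normD _ _) (lerD first_cell cellsN)) last_cell) _.
have NE : N%:R / n%:R = p N - p 0%N by rewrite !pE; ring.
rewrite NE.
have l1 : C3 * (p N - a) <= C3 * (b - a) by rewrite ler_wpM2l // lerD2r.
have l2 : C2 * (n%:R * (b - p N)) <= C2 by rewrite ler_piMr.
have l3 : 0 <= C2 * (n%:R * (p 0%N - a)) by rewrite !mulr_ge0 ?subr_ge0 // ltW.
by rewrite !mulrBr mulr1 in l1 l3 l2 *; lra.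
Qed.

Lemma measurable_bspline_rec (s : seq R) i j :
  measurable_fun [set: measurableTypeR R] (bspline_rec s i j : measurableTypeR R -> R).
Proof.
elim: j i => [|j ih] i /=.
  apply: measurable_fun_ifT => //.
  have -> : (fun x : measurableTypeR R => s`_i <= x < s`_i.+1) =
    (fun x => (s`_i <= x) && (x < s`_i.+1)) by [].
  by apply: measurable_and; [exact: measurable_fun_ler|exact: measurable_fun_ltr].
by apply: measurable_funD; apply: measurable_funM => //; apply: measurable_funM => //;
  apply: measurable_funB.
Qed.

(** For [k = d + 2] the stated exponent is [(3 d^2 + 5 d - 5) / 2], which is at least [d] when
    [d >= 1]. The left side is at most [d (8 d)^(d-1) = 8^(d-1) d^d]. *)
Lemma lattice_constant_le (d : nat) : (0 < d)%N ->
  d%:R * d.+1%:R ^+ d.-1 <=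
  8 ^+ d.-1 * d%:R `^ ((3 * d.+2%:R ^+ 2 - 7 * d.+2%:R - 3) / 2) :> R.
Proof.
move=> d0; have d1 : 1 <= d%:R :> R by rewrite ler1n.
apply: (@le_trans _ _ (d%:R * (8 * d%:R) ^+ d.-1)).
  rewrite ler_wpM2l // lerXn2r ?nnegrE //; rewrite -natr1; lra.
rewrite exprMn mulrCA ler_wpM2l ?exprn_ge0 //.
rewrite -exprS prednK // -powR_mulrn //; apply: ler_powR => //.
have -> : d.+2%:R = d%:R + 2 :> R by rewrite -addn2 natrD.
by nra.
Qed.

End riemann_sum.

(** * Grouping by values and adding the errors *)

Section assembly.
Variable R : realType.
Local Notation mu := (@lebesgue_measure R).

Lemma sum_fibres (T : Type) (s : seq T) (phi : T -> int) (js : seq int)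
    (F : int -> R) : uniq js -> all (fun x => phi x \in js) s ->
  \sum_(x <- s) F (phi x) =
  \sum_(j <- js) (size [seq x <- s | phi x == j])%:R * F j.
Proof.
move=> ujs; elim: s => [|x s ih] /=.
  by rewrite big_nil big1 // => j _; rewrite mul0r.
move=> /andP[xj sj]; rewrite big_cons ih //.
have -> : F (phi x) = \sum_(j <- js) (phi x == j)%:R * F j.
  rewrite (bigD1_seq (phi x)) //= eqxx mul1r big1 ?addr0 // => j.
  by rewrite eq_sym => /negPf ->; rewrite mul0r.
rewrite -big_split; apply: eq_bigr => j _ /=; rewrite -mulrDl.
by case: eqP => _ /=; rewrite ?add0r // addrC natr1.
Qed.

Lemma finite_factorizations d (g : 'cV[int]_(2 + d)) (n : nat) (P : 'cV[int]_(2 + d) -> Prop) :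
  (forall i, 0 < g i 0) ->
  exists s : seq 'cV[int]_(2 + d), uniq s /\
    (forall x, x \in s <-> factorizations g n%:Z x /\ P x).
Proof.
move=> g0.
exists [seq x <- [seq y^T | y <- int_box n (2 + d)] | `[< factorizations g n%:Z x /\ P x >]].
split.
  by rewrite filter_uniq // (map_inj_uniq (@trmx_inj _ _ _)) int_box_uniq.
move=> x; rewrite mem_filter; split=> [/andP[/asboolP] //|xP].
apply/andP; split; first exact/asboolP.
apply/mapP; exists x^T; last by rewrite trmxK.
rewrite mem_int_box; apply/forallP => j; rewrite mxE.
have [[x0 gx] _] := xP.
rewrite ger0_norm ?x0 // -gx /cdot (bigD1 j) //=.
apply: (@le_trans _ _ (g j 0 * x j 0)).
  by rewrite ler_peMl //; have := g0 j; lia.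
by rewrite lerDl; apply: sumr_ge0 => l _; rewrite mulr_ge0 // ltW.
Qed.

Lemma fsum_seq (T : choiceType) (X : set T) (s : seq T) (F : T -> R) : uniq s ->
  (forall x, x \in s <-> X x) -> \sum_(x \in X) F x = \sum_(x <- s) F x.
Proof.
move=> us hs; have -> : X = [set` s] by apply/seteqP; split => x /hs.
by rewrite -fsbig_seq.
Qed.

(** The first term of the bound is the lattice error times [C1] at each node [j / n], of which there
    are at most [n (b - a) + 1]; the second is [n ^ d] times the error of the Riemann sum. *)
Lemma factorization_sum_finite (d : nat) (m g : 'cV[int]_(2 + d))
    (A : 'M[int]_(2, 2 + d)) (n : nat) (a b : R) (f : R -> R) (C1 C2 C3 : R) :
  (0 < d)%N -> A = col_mx m^T g^T -> (forall i, 0 < g i 0) ->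
  (forall y : 'cV[int]_2, exists x : 'cV[int]_(2 + d), A *m x = y) ->
  (0 < n)%N -> n%:R^-1 <= b - a ->
  {within `[a, b], continuous f} ->
  (forall x, a <= x <= b -> `|f x| <= C1) ->
  (forall x, a <= x <= b -> `|f x * trunc_power1 A x| <= C2) ->
  0 <= C3 ->
  (forall x y, a <= x <= b -> a <= y <= b ->
    `|f x * trunc_power1 A x - f y * trunc_power1 A y| <= C3 * `|x - y|) ->
  `| \sum_(x \in [set x : 'cV[int]_(2 + d) | factorizations g n%:Z x /\
                     a <= (cdot m x)%:~R / n%:R <= b])
         f ((cdot m x)%:~R / n%:R)
       - n%:R ^+ d.+1 *
         \int[mu]_(t in `[a, b])
           (f t * (bspline (ratio_knots R m g) t
                   / ((d.+1)`!%:R * \prod_(i < 2 + d) (g i 0)%:~R))) |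
  <= (n%:R * (b - a) + 1) * ((d * (d * n).+1 ^ d.-1)%:R * C1) +
     n%:R ^+ d * (C3 * (b - a) + 2 * C2).
Proof.
move=> d0 AE g0 surj n0 nab fcont hC1 hC2 C30 hC3.
have nR : 0 < n%:R :> R by rewrite ltr0n.
have nN : n%:R != 0 :> R by rewrite gt_eqF.
set h := fun x => f x * trunc_power1 A x.
have -> : \int[mu]_(t in `[a, b]) (f t * (bspline (ratio_knots R m g) t
     / ((d.+1)`!%:R * \prod_(i < 2 + d) (g i 0)%:~R))) = \int[mu]_(t in `[a, b]) h t.
  rewrite /Rintegral; congr fine; apply: ae_eq_integral => //.
  - apply/measurable_EFinP; apply: measurable_funM.
      exact: subspace_continuous_measurable_fun.
    apply: measurable_funTS; apply: measurable_funM => //.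
    by apply: measurable_funM => //; exact: measurable_bspline_rec.
  - apply/measurable_EFinP; apply: subspace_continuous_measurable_fun => //.
    exact: (@lipschitz_within_continuous _ _ _ C3).
  exists [set` sort <=%O (ratio_knots R m g)]; split.
  - apply: countable_measurable => [r|]; first exact: measurable_set1.
    by apply: finite_set_countable; exact: finite_seq.
  - apply: countable_lebesgue_measure0.
    by apply: finite_set_countable; exact: finite_seq.
  move=> x /=; apply: contra_notP => xk _; rewrite /h.
  rewrite (trunc_power1_bspline AE) // => p ps; apply/eqP => xp.
  by apply: xk; rewrite xp; exact: mem_nth.
pose j0 := Num.ceil (n%:R * a); pose j1 := Num.floor (n%:R * b).
have j0a : a <= j0%:~R / n%:R.
  by rewrite ler_pdivlMr // mulrC; exact: ceil_ge.
have j0a' : j0%:~R / n%:R - a <= n%:R^-1.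
  rewrite lerBlDr ler_pdivrMr // mulrDl mulVf // [a * _]mulrC addrC.
  have := ceil_itv (n%:R * a); rewrite -/j0 intrB => /andP[h1 _].
  by apply/ltW; rewrite -ltrBlDr.
have j1b : j1%:~R / n%:R <= b.
  by rewrite ler_pdivrMr // mulrC; exact: floor_le.
have j1b' : b - j1%:~R / n%:R <= n%:R^-1.
  rewrite lerBlDr (_ : _ + _ = (j1%:~R + 1) / n%:R); last by field.
  rewrite ler_pdivlMr //; have := floor_itv (n%:R * b); rewrite -/j1 intrD => /andP[_ h1].
  by rewrite mulrC ltW.
(* An interval of length at least [1 / n] contains a node. *)
have j01 : j0 <= j1.
  rewrite -ltzD1 -(ltr_int R) intrD.
  have := ceil_itv (n%:R * a); rewrite -/j0 intrB => /andP[h1 _].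
  have := floor_itv (n%:R * b); rewrite -/j1 intrD => /andP[_ h2].
  have : 1 <= n%:R * (b - a) by rewrite -ler_pdivrMl // mulr1.
  rewrite mulrBr; lra.
pose N := `|j1 - j0|%N.
have NE : j1 = j0 + N%:Z by rewrite /N; clear -j01; lia.
pose js := [seq j0 + i%:Z | i <- iota 0 N.+1].
have ujs : uniq js by rewrite map_inj_uniq ?iota_uniq // => i j /addrI[].
have mem_js (j : int) : (j \in js) = (a <= j%:~R / n%:R <= b).
  have -> : (a <= j%:~R / n%:R <= b) = (j0 <= j) && (j <= j1).
    by rewrite ceil_le_int floor_ge_int ler_pdivlMr // ler_pdivrMr // ![_ * n%:R]mulrC.
  rewrite /js NE; move: (j0) (N) => u v; clear; apply/mapP/andP => [[i]|[h1 h2]].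
    by rewrite mem_iota => hi ->; split; lia.
  by exists `|(j - u)%R|%N; [rewrite mem_iota|]; lia.
have [s [us hs]] := finite_factorizations n
  (fun x => a <= (cdot m x)%:~R / n%:R <= b) g0.
rewrite (fsum_seq _ us hs).
rewrite (@sum_fibres _ s (cdot m) js (fun j => f (j%:~R / n%:R))) //; last first.
  by apply/allP => x /hs[_]; rewrite mem_js.
set Nj := fun j => (size [seq x <- s | cdot m x == j])%:R : R.
have NjE j : j \in js -> `|Nj j - n%:R ^+ d * trunc_power1 A (j%:~R / n%:R)| <=
    (d * (d * n).+1 ^ d.-1)%:R.
  move=> jjs; apply: (count_lattice_solutions _ AE) => //.
    by rewrite filter_uniq.
  move=> x; rewrite mem_filter; split.
    by move=> /andP[/eqP mx /hs[[x0 gx] _]]; split.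
  move=> [x0 gx mx]; rewrite mx eqxx /=; apply/hs; split; first by split.
  by rewrite mx -mem_js.
have sum_h : \sum_(0 <= i < N.+1) h ((j0 + i%:Z)%:~R / n%:R) =
    \sum_(j <- js) h (j%:~R / n%:R).
  by rewrite big_map /index_iota subn0.
have riem := @riemann_sum_lipschitz R h C2 C3 a b n j0 N C30 n0 hC2 hC3 j0a j0a' _ _.
rewrite -NE in riem; have {}riem := riem j1b j1b'; rewrite sum_h in riem.
have -> : \sum_(j <- js) Nj j * f (j%:~R / n%:R) - n%:R ^+ d.+1 * \int[mu]_(t in `[a, b]) h t =
  \sum_(j <- js) (Nj j - n%:R ^+ d * trunc_power1 A (j%:~R / n%:R)) * f (j%:~R / n%:R) +
  n%:R ^+ d * (\sum_(j <- js) h (j%:~R / n%:R) - n%:R * \int[mu]_(t in `[a, b]) h t).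
  under [X in _ = X + _]eq_bigr do rewrite mulrBl.
  rewrite sumrB mulrBr exprSr -mulrA addrA; congr (_ - _).
  rewrite mulr_sumr -sumrB -big_split; apply: eq_bigr => j _ /=.
  by rewrite /h; ring.
apply: le_trans (ler_normD _ _) _; apply: lerD; last first.
  by rewrite normrM ger0_norm ?exprn_ge0 // ler_wpM2l ?exprn_ge0.
apply: le_trans (ler_norm_sum _ _ _) _.
apply: (@le_trans _ _ (\sum_(j <- js) ((d * (d * n).+1 ^ d.-1)%:R * C1))).
  rewrite big_seq [leRHS]big_seq; apply: ler_sum => j jjs.
  by rewrite normrM ler_pM // ?NjE // hC1 // -mem_js.
rewrite big_const_seq count_predT size_map size_iota iter_addr_0 -[leLHS]mulr_natl.
have C1_ge0 : 0 <= C1.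
  by apply: le_trans (hC1 a _) => //; rewrite lexx /=; rewrite -subr_ge0 (le_trans _ nab) // invr_ge0 ltW.
rewrite ler_wpM2r ?mulr_ge0 // -natr1 lerD2r.
have -> : N%:R = (j1%:~R / n%:R - j0%:~R / n%:R) * n%:R :> R.
  by rewrite NE intrD -pmulrn; field.
by rewrite mulrC ler_pM2l // lerB.
Qed.

End assembly.
Theorem theoremC (R : realType) (k : nat) (hk : (3 <= k)%N)
    (m g : 'cV[int]_k) (hg : forall i : 'I_k, 0 < g i 0)
    (A : 'M[int]_(2, k)) (hA : A = col_mx m^T g^T)
    (hsurj : forall b : 'cV[int]_2, exists x : 'cV[int]_k, A *m x = b)
    (n : nat) (hn : (1 <= n)%N) (alpha beta : \bar R)
    (hab : ((n%:R^-1)%R%:E <= beta - alpha)%E)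
    (f : R -> R) (C1 C2 C3 : R)
    (hf : {within eitv alpha beta, continuous f})
    (hC1 : forall x, eitv alpha beta x -> `|f x| <= C1)
    (hC2 : forall x, eitv alpha beta x ->
            `|f x * trunc_power1 A x| <= C2)
    (hC3 : C3.-lipschitz_(eitv alpha beta)
            (fun x : R => f x * trunc_power1 A x)) :
  ((`| \sum_(x \in [set x : 'cV[int]_k | factorizations g n%:Z x /\
                     eitv alpha beta ((cdot m x)%:~R / n%:R)])
         f ((cdot m x)%:~R / n%:R)
       - n%:R ^+ k.-1 *
         \int[@lebesgue_measure R]_(t in eitv alpha beta)
           (f t * (bspline (ratio_knots R m g) t
                   / ((k.-1)`!%:R * \prod_(i < k) (g i 0)%:~R))) |)%R%:E
   <= E3 alpha beta C1 C2 C3 n k)%E.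
Proof.
have [d dk] : exists d, k = (2 + d)%N by exists (k - 2)%N; rewrite subnKC // ltnW.
subst k; have d0 : (0 < d)%N by rewrite -(ltn_add2l 2).
have nR : 0 < n%:R :> R by rewrite ltr0n.
(* Two distinct points of the interval force [C3] to be nonnegative; one of them does so for [C1]
   and [C2]. *)
have eitv2 : exists x y, [/\ eitv alpha beta x, eitv alpha beta y & x < y].
  move: hab; rewrite /eitv; case: (alpha) (beta) => [a||] [b||] //=.
  - rewrite -EFinB lee_fin => nab; exists a, b.
    have ab : a < b by rewrite -subr_gt0 (lt_le_trans _ nab) // invr_gt0.
    by rewrite !lee_fin !lexx !(ltW ab).
  - by move=> _; exists a, (a + 1); rewrite !leey !lee_fin lexx lerDl ltrDl ltr01 ler01.
  - by move=> _; exists (b - 1), b; rewrite !leNye !lee_fin lexx lerBlDr ltrBlDr ltrDl ltr01 lerDl ler01.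
  - by move=> _; exists 0, 1; rewrite !leNye !leey ltr01.
have [x0 [y0 [x0P y0P x0y0]]] := eitv2.
have C1_ge0 : 0 <= C1 by apply: le_trans (hC1 _ x0P).
have C2_ge0 : 0 <= C2 by apply: le_trans (hC2 _ x0P).
have lip x y : eitv alpha beta x -> eitv alpha beta y ->
    `|f x * trunc_power1 A x - f y * trunc_power1 A y| <= C3 * `|x - y|.
  by move=> hx hy; exact: (hC3 (x, y)).
have C3_ge0 : 0 <= C3.
  have xy : 0 < `|x0 - y0| by rewrite normr_gt0 subr_eq0 lt_eqF.
  by rewrite -(pmulr_lge0 _ xy); apply: le_trans (lip _ _ x0P y0P).
have dE : (2 + d)%:R - 2 = d%:R :> R by rewrite natrD addrAC subrr add0r.
pose K0 : R := 8 ^+ (2 + d - 3) *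
  ((2 + d)%:R - 2) `^ ((3 * (2 + d)%:R ^+ 2 - 7 * (2 + d)%:R - 3) / 2).
have K0_gt0 : 0 < K0.
  by rewrite /K0 dE mulr_gt0 ?exprn_gt0 // powR_gt0 // ltr0n.
rewrite /E3 -[C1 * _ * _]mulrA -/K0.
(* On an infinite interval the bound is [+oo] unless [C1 * K0 + C3] vanishes; in that case [C1 = 0],
   so [f] is 0 there and both the sum and the integral are 0. *)
have [ba|fin] := eqVneq (beta - alpha)%E +oo%E.
  rewrite ba.
  have [KC|KC] := ltP 0 (C1 * K0 + C3).
    rewrite gt0_mulye ?lte_fin // addye // gt0_mulye ?lte_fin ?exprn_gt0 // addye //.
    exact: leey.
  have C10 : C1 = 0.
    have := mulr_ge0 C1_ge0 (ltW K0_gt0) => h.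
    have : C1 * K0 = 0 by lra.
    by move/eqP; rewrite mulf_eq0 (gt_eqF K0_gt0) orbF => /eqP.
  have C30 : C3 = 0 by move: KC; rewrite C10 mul0r add0r; lra.
  have f0 x : eitv alpha beta x -> f x = 0.
    by move=> /hC1; rewrite C10 normr_le0 => /eqP.
  rewrite C10 C30 !mul0r !addr0 mule0 add0e -EFinM lee_fin.
  rewrite fsbig1 => [|x [_ hx]]; last exact: f0.
  rewrite (_ : \int[_]_(t in _) _ = 0) ?mulr0 ?subr0 ?normr0; last first.
    by rewrite /Rintegral integral0_eq // => t ht; rewrite f0 // mul0r.
  by rewrite !mulr_ge0 // exprn_ge0.
have [a [b [aE bE]]] : exists a b, alpha = a%:E /\ beta = b%:E.
  by move: hab fin; case: (alpha) (beta) => [a||] [b||] //= _ _; exists a, b.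
subst alpha beta.
have eitvE x : eitv a%:E b%:E x <-> a <= x <= b by rewrite /eitv /= !lee_fin.
have eitv_itv : eitv a%:E b%:E = `[a, b]%classic.
  by apply/seteqP; split => x; rewrite /= in_itv /= => /eitvE.
have nab : n%:R^-1 <= b - a by move: hab; rewrite -EFinB lee_fin.
rewrite -EFinB -!(EFinM, EFinD) lee_fin.
have -> : [set x : 'cV[int]_(2 + d) | factorizations g n%:Z x /\
    eitv a%:E b%:E ((cdot m x)%:~R / n%:R)] =
  [set x | factorizations g n%:Z x /\ a <= (cdot m x)%:~R / n%:R <= b].
  by apply/seteqP; split => x [h1 /eitvE h2].
rewrite eitv_itv.
apply: le_trans (@factorization_sum_finite R d m g A n a b f C1 C2 C3 d0 hA hg hsurj
  hn nab _ _ _ C3_ge0 _) _.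
- by rewrite -eitv_itv.
- by move=> x /eitvE; exact: hC1.
- by move=> x /eitvE; exact: hC2.
- by move=> x y /eitvE hx /eitvE hy; exact: lip.
have n1 : 1 <= n%:R :> R by rewrite ler1n.
(* Since [n >= 1], [d * n + 1 <= (d + 1) * n] separates the power of [n] from the constant. *)
have eK : (d * (d * n).+1 ^ d.-1)%:R <= K0 * n%:R ^+ d.-1 :> R.
  apply: (@le_trans _ _ (d%:R * d.+1%:R ^+ d.-1 * n%:R ^+ d.-1)).
    rewrite natrM natrX -mulrA -exprMn ler_wpM2l // lerXn2r ?nnegrE //.
    by rewrite -natrM ler_nat mulSn -[X in (X <= _)%N]add1n leq_add2r.
  rewrite ler_wpM2r ?exprn_ge0 //.
  have := lattice_constant_le R d0; rewrite /K0 dE.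
  by rewrite (_ : 2 + d - 3 = d.-1)%N // -subn1 -[3%N]/(2 + 1)%N subnDl.
have -> : (2 + d - 2 = d)%N by rewrite addKn.
have -> : (2 + d - 3 = d.-1)%N by rewrite -subn1 -[3%N]/(2 + 1)%N subnDl.
have eC : (d * (d * n).+1 ^ d.-1)%:R * C1 <= C1 * K0 * n%:R ^+ d.-1.
  by rewrite mulrC -mulrA ler_wpM2l.
have ba0 : 0 <= b - a by apply: le_trans nab; rewrite invr_ge0 ltW.
have nd : n%:R ^+ d = n%:R * n%:R ^+ d.-1 :> R by rewrite -exprS prednK.
(* In the node count [n (b - a) + 1], the first summand raises the power of [n] to [d = k - 2], and
   the 1 is the source of the separate [n ^ (k - 3)] term of [E3]. *)
have := ler_wpM2l (addr_ge0 (mulr_ge0 (ltW nR) ba0) ler01) eC.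
rewrite nd; move: (n%:R ^+ d.-1) => q; lra.
Qed.
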